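(* Let $d\ge 2$ and let $\Xi=(\xi_t)_{t\in\mathbb{Z}^+}$ be a time-homogeneous Markov chain whose state-space $\mathcal{S}$ is an unbounded subset of $\mathbb{Z}^d$. Suppose that: (A1) there exist $\kappa>0$, $k\in\mathbb{N}$ and $n_0\in\mathbb{N}$ such that $\mathbb{P}[\xi_{t+n_0}-\xi_t=\mathbf{y}\mid \xi_t=\mathbf{x}]\ge\kappa$ for all $t\in\mathbb{Z}^+$, all $\mathbf{x}\in\mathcal{S}$ and all $\mathbf{y}\in\{\pm k\mathbf{e}_i: i=1,\dots,d\}$; (A2) there exists $B_0\in(0,\infty)$ such that $\mathbb{E}[\|\xi_{t+1}-\xi_t\|^2\mid\xi_t=\mathbf{x}]\le B_0$ for all $\mathbf{x}\in\mathcal{S}$. Suppose also that the mean drift $\mu(\mathbf{x})=\mathbb{E}[\xi_{t+1}-\xi_t\mid\xi_t=\mathbf{x}]$ satisfies, for $\mathbf{x}\in\mathcal{S}$ as $\|\mathbf{x}\|\to\infty$, $$\|\mu(\mathbf{x})\|=O(\|\mathbf{x}\|^{-1}).$$ Then for any $\alpha\in(0,\pi)$, any $\mathbf{u}\in\mathbb{S}_d$, and any $\mathbf{x}\in\mathcal{S}\cap\mathcal{W}_d(\mathbf{u};\alpha)$, $$\mathbb{P}[\tau_\alpha<\infty\mid\xi_0=\mathbf{x}]=1.$$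
   Context: $\mathbb{Z}^+=\{0,1,2,\dots\}$, $\mathbb{N}=\{1,2,\dots\}$. $\|\cdot\|$ is the Euclidean norm on $\mathbb{R}^d$, $\mathbf{e}_1,\dots,\mathbf{e}_d$ is the standard orthonormal basis, $\mathbf{u}\cdot\mathbf{v}$ is the scalar product, and $\hat{\mathbf{x}}=\mathbf{x}/\|\mathbf{x}\|$ for $\mathbf{x}\ne\mathbf{0}$. $\mathbb{S}_d:=\{\mathbf{u}\in\mathbb{R}^d:\|\mathbf{u}\|=1\}$ is the unit sphere in $\mathbb{R}^d$. For $\mathbf{u}\in\mathbb{S}_d$ and $\alpha\in(0,\pi)$, $\mathcal{W}_d(\mathbf{u};\alpha):=\{\mathbf{x}\in\mathbb{R}^d:\mathbf{u}\cdot\hat{\mathbf{x}}>\cos\alpha\}$ is the open circular cone with apex $\mathbf{0}$, principal direction $\mathbf{u}$ and half-angle $\alpha$. The first exit time from the cone is $\tau_\alpha:=\min\{t\in\mathbb{Z}^+:\xi_t\notin\mathcal{W}_d(\mathbf{u};\alpha)\}$ (with $\min\emptyset=\infty$); the dependence on $\mathbf{u}$ is suppressed. The chain is not assumed spatially homogeneous. *)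

(* Defs.v *)
From HB Require Import structures.
From mathcomp Require Import all_boot all_order all_algebra.
From mathcomp Require Import all_classical all_reals all_analysis.
Set Implicit Arguments.
Unset Strict Implicit.
Unset Printing Implicit Defensive.
Import Order.TTheory GRing.Theory Num.Theory.
Import numFieldNormedType.Exports.
Local Open Scope classical_set_scope.
Local Open Scope ring_scope.

Section Euclidean.
Context {R : realType} {d : nat}.

Definition dot (u v : 'rV[R]_d) : R := \sum_(i < d) u 0 i * v 0 i.

(* The library norm `|x| on 'rV[R]_d is the sup norm, hence this definition. *)
Definition enorm (x : 'rV[R]_d) : R := Num.sqrt (dot x x).

(* The apex 0 has no direction; it is excluded explicitly, because
   (enorm 0)^-1 *: 0 = 0 would put it in the cone as soon as cos alpha < 0. *)
Definition cone (u : 'rV[R]_d) (alpha : R) : set 'rV[R]_d :=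
  [set x | x != 0 /\ cos alpha < dot u ((enorm x)^-1 *: x)].

Definition toR (x : 'rV[int]_d) : 'rV[R]_d := map_mx intr x.

End Euclidean.

Section Conditioning.
Context {R : realType} {disp : measure_display} {T : measurableType disp}.
Local Open Scope ereal_scope.

(* Elementary conditioning; only used for events B with 0 < P B. *)
Definition cprob (P : probability T R) (A B : set T) : \bar R :=
  P (A `&` B) / P B.

Definition cexp (P : probability T R) (X : T -> R) (B : set T) : \bar R :=
  (\int[P]_(w in B) (X w)%:E) / P B.

End Conditioning.

Section Chain.
Context {R : realType} {disp : measure_display} {T : measurableType disp}.
Context {d : nat}.
Implicit Types (S : set 'rV[int]_d) (P : 'rV[int]_d -> probability T R).
Implicit Types (xi : nat -> T -> 'rV[int]_d).

Definition at_time xi (t : nat) (x : 'rV[int]_d) : set T :=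
  [set w | xi t w = x].

Definition path_upto xi (t : nat) (s : nat -> 'rV[int]_d) : set T :=
  [set w | forall i : nat, (i <= t)%N -> xi i w = s i].

(* A time-homogeneous Markov chain with countable state space S is given by
   the laws P x = P[ . | xi_0 = x] for x in S; its one-step transition
   probabilities are P x (xi_1 = y). Values of P outside S are irrelevant. *)
Record markov_chain S P xi : Prop := MarkovChain {
  mc_measurable : forall t x, measurable (at_time xi t x) ;
  mc_start : forall x, S x -> P x (at_time xi 0 x) = 1%E ;
  mc_states : forall x t, S x -> P x [set w | S (xi t w)] = 1%E ;
  mc_markov : forall x t (s : nat -> 'rV[int]_d), S x ->
    (0 < P x (path_upto xi t s))%E ->
    cprob (P x) (at_time xi t.+1 (s t.+1)) (path_upto xi t s)
      = P (s t) (at_time xi 1 (s t.+1))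
}.

(* E[xi_{t+1} - xi_t | xi_t = x], which by time-homogeneity does not depend on
   t and equals E_x[xi_1 - xi_0]. *)
Definition mean_drift P xi (x : 'rV[int]_d) : 'rV[R]_d :=
  \row_(i < d) fine ('E_(P x)[fun w => toR (xi 1%N w - xi 0%N w) 0 i]).

(* The infimum of the empty set is +oo. *)
Definition exit_time xi (u : 'rV[R]_d) (alpha : R) (w : T) : \bar R :=
  ereal_inf [set t%:R%:E | t in [set t : nat | ~ cone u alpha (toR (xi t w))]].

End Chain.

(* Main.v *)
(* Let g x be the probability that the chain started at x never leaves the cone W.
   By the Markov property g = 1_W E_x[g(xi_1)], so sup g = p < 1 would force
   g <= p g, hence g = 0; it suffices to bound g away from 1. Moreover g is
   subharmonic for every iterate of the kernel, in particular for the n0-step one,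
   which is elliptic by (A1).

   The bound is transported through space by comparison with the Gaussians
   f(z) = exp(-lambda |z - a|^2 / r^2), |a| ~ r. Moment and drift bounds give
   E_x |xi_n0 - a|^2 <= |x - a|^2 + L with L independent of r; since
   e^s >= 1 + s always, and the elliptic steps add a second-order term of size
   lambda^2 / r^2, f is strictly subharmonic for c r <= |x - a| once lambda is large
   (large jumps cost nothing). Hence if g <= 1 - delta on the ball B(a, c r), the
   maximum principle for g + delta f yields g <= 1 - eta delta on B(a, r / 2), with
   eta independent of r. Starting from the complement of W, where g = 0, finitely
   many such steps reach all directions at large distance, and a walk of bounded
   length with elliptic steps takes care of bounded x. *)
Require Import Defs.
From HB Require Import structures.
From mathcomp Require Import all_boot all_order all_algebra.
From mathcomp Require Import all_classical all_reals all_analysis.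
From mathcomp Require Import measurable_realfun ring lra.
Import Order.TTheory GRing.Theory Num.Theory.
Import numFieldNormedType.Exports.
Local Open Scope classical_set_scope.
Local Open Scope ring_scope.
Set Implicit Arguments.
Unset Strict Implicit.
Unset Printing Implicit Defensive.

(** * Markov chains with countable state space *)

Section CountableValued.
Context {disp : measure_display} {T : measurableType disp} {R : realType}.
Context {U : countType} (f : T -> U).
Hypothesis mf : forall u, measurable (f @^-1` [set u]).

Lemma measurable_preimage_countable (A : set U) : measurable (f @^-1` A).
Proof.
rewrite -[A]image_id -bigcup_imset1 preimage_bigcup bigcup_mkcond.
apply: countable_bigcupT_measurable => [|u]; first exact: countableP.
by case: ifP => // _; exact: mf.
Qed.

Lemma measurable_comp_countable {disp'} {T' : measurableType disp'}
  (D : set T) (phi : U -> T') : measurable_fun D (fun w => phi (f w)).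
Proof.
move=> mD B mB; apply: measurableI => //.
by rewrite -[X in measurable X]/(f @^-1` (phi @^-1` B));
  exact: measurable_preimage_countable.
Qed.

(** The integrand is constant on each fibre of [f], and the fibres are listed through [pickle];
    codes of no element of [U] contribute 0. *)
Lemma ge0_integral_fibers (mu : measure T R) (D : set T) (phi : U -> \bar R) :
  measurable D -> (forall u, 0 <= phi u)%E ->
  (\int[mu]_(w in D) phi (f w) =
   \sum_(0 <= n <oo) (if @pickle_inv U n is Some u
                      then phi u * mu (D `&` f @^-1` [set u]) else 0))%E.
Proof.
move=> mD phi0.
have DE : D = \bigcup_n (D `&` f @^-1` [set u | pickle u = n]).
  apply/seteqP; split=> w; last by case=> n _ [].
  by move=> Dw; exists (pickle (f w)).
rewrite [in LHS]DE ge0_integral_bigcup//.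
- apply: eq_eseriesr => n _; case E : (@pickle_inv U n) => [u|].
    have -> : D `&` f @^-1` [set u | pickle u = n] = D `&` f @^-1` [set u].
      apply/seteqP; split=> w [Dw] /= fw; split=> //=.
        by have := pickleK_inv (f w); rewrite fw E => -[].
      by have := @pickle_invK U n; rewrite fw E.
    rewrite -integral_cst; last exact: measurableI.
    by apply: eq_integral => w /set_mem[_] /= ->.
  have -> : D `&` f @^-1` [set u | pickle u = n] = set0; last exact: integral_set0.
  by rewrite -subset0 => w [_] /= fw; have := pickleK_inv (f w); rewrite fw E.
- by move=> n; apply: measurableI => //; exact: measurable_preimage_countable.
- exact: measurable_comp_countable.
- by move=> i j _ _ [w [[_ /= <-] [_ /= <-]]].
Qed.

End CountableValued.

(** Turns identities between point probabilities into identities between integrals, possibly over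
    two different spaces: both sides become the same series. *)
Lemma eq_ge0_integral_fibers {disp disp'} {T : measurableType disp}
  {T' : measurableType disp'} {R : realType} {U : countType}
  (f : T -> U) (f' : T' -> U)
  (mu : measure T R) (mu' : measure T' R) (D : set T) (D' : set T') (c : R)
  (phi : U -> \bar R) :
  (forall u, measurable (f @^-1` [set u])) ->
  (forall u, measurable (f' @^-1` [set u])) ->
  measurable D -> measurable D' -> (forall u, 0 <= phi u)%E ->
  (forall u, mu (D `&` f @^-1` [set u]) =
             c%:E * mu' (D' `&` f' @^-1` [set u]))%E ->
  (\int[mu]_(w in D) phi (f w) = c%:E * \int[mu']_(w in D') phi (f' w))%E.
Proof.
move=> mf mf' mD mD' phi0 E; rewrite !ge0_integral_fibers//.
rewrite -nneseriesZl; last first.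
  by move=> n _; case: pickle_inv => // u; rewrite mule_ge0.
apply: eq_eseriesr => n _; case: pickle_inv => [u|]; last by rewrite mule0.
by rewrite E muleCA.
Qed.

(** Here [F] and [G] need not factor through [f], which only cuts [D] into countably many pieces. It
    serves with [f] the past of the chain. *)
Lemma eq_ge0_integral_partition {disp} {T : measurableType disp} {R : realType}
  {U : countType} (f : T -> U) (mu : measure T R) (D : set T)
  (F G : T -> \bar R) :
  (forall u, measurable (f @^-1` [set u])) -> measurable D ->
  measurable_fun D F -> measurable_fun D G ->
  (forall w, 0 <= F w)%E -> (forall w, 0 <= G w)%E ->
  (forall u, \int[mu]_(w in D `&` f @^-1` [set u]) F w =
             \int[mu]_(w in D `&` f @^-1` [set u]) G w)%E ->
  (\int[mu]_(w in D) F w = \int[mu]_(w in D) G w)%E.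
Proof.
move=> mf mD mF mG F0 G0 FG.
have DE : D = \bigcup_n (D `&` f @^-1` [set u | pickle u = n]).
  apply/seteqP; split=> w; last by case=> n _ [].
  by move=> Dw; exists (pickle (f w)).
have mB n : measurable (D `&` f @^-1` [set u | pickle u = n]).
  by apply: measurableI => //; exact: measurable_preimage_countable.
have tB : trivIset setT (fun n => D `&` f @^-1` [set u | pickle u = n]).
  by move=> i j _ _ [w [[_ /= <-] [_ /= <-]]].
rewrite {1 2}DE !ge0_integral_bigcup -?DE//.
apply: eq_eseriesr => n _; case E : (@pickle_inv U n) => [u|].
  suff -> : f @^-1` [set u | pickle u = n] = f @^-1` [set u] by exact: FG.
  apply/seteqP; split=> w /= fw.
    by have := pickleK_inv (f w); rewrite fw E => -[].
  by have := @pickle_invK U n; rewrite fw E.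
have -> : D `&` f @^-1` [set u | pickle u = n] = set0; last by rewrite !integral_set0.
by rewrite -subset0 => w [_] /= fw; have := pickleK_inv (f w); rewrite fw E.
Qed.

(** * The Markov property for integrals, and survival probabilities *)

Section Chain.
Context {R : realType} {disp : measure_display} {T : measurableType disp}.
Context {d : nat} {S : set 'rV[int]_d} (P : 'rV[int]_d -> probability T R).
Context (xi : nat -> T -> 'rV[int]_d) (mc : markov_chain S P xi).
Local Notation V := 'rV[int]_d.
Implicit Types (x y : V) (W : set V) (phi : V -> \bar R) (s : nat -> V).

Let mxi t x : measurable (xi t @^-1` [set x]).
Proof. exact: (mc_measurable mc). Qed.

Lemma measurable_chain {disp'} {T' : measurableType disp'} t D (phi : V -> T') :
  measurable_fun D (fun w => phi (xi t w)).
Proof. exact: measurable_comp_countable. Qed.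

Lemma measurable_chain2 {disp'} {T' : measurableType disp'} t t' D
  (phi : V -> V -> T') : measurable_fun D (fun w => phi (xi t w) (xi t' w)).
Proof.
apply: (@measurable_comp_countable _ _ _ (fun w => (xi t w, xi t' w)) _ _ _ _
  (fun u => phi u.1 u.2)) => -[x y].
rewrite [X in measurable X](_ : _ = xi t @^-1` [set x] `&` xi t' @^-1` [set y]).
  exact: measurableI.
by apply/seteqP; split=> w /= [-> ->].
Qed.

Lemma measurable_path_upto t s : measurable (path_upto xi t s).
Proof.
have -> : path_upto xi t s =
    \bigcap_i (if (i <= t)%N then xi i @^-1` [set s i] else setT).
  apply/seteqP; split=> w /= H i.
    by move=> _; case: ifP => // /H.
  by move=> it; have := H i I; rewrite it.
by apply: bigcap_measurable => // i _; case: ifP.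
Qed.

Definition in_before W n : set T := [set w | forall i, (i < n)%N -> W (xi i w)].

Lemma measurable_in_before W n : measurable (in_before W n).
Proof.
have -> : in_before W n = \bigcap_i (if (i < n)%N then xi i @^-1` W else setT).
  apply/seteqP; split=> w /= H i.
    by move=> _; case: ifP => // /H.
  by move=> it; have := H i I; rewrite it.
apply: bigcap_measurable => // i _; case: ifP => // _.
exact: measurable_preimage_countable.
Qed.

Lemma chain_in_states t x : S x -> \forall w \ae (P x), S (xi t w).
Proof.
move=> Sx; exists (xi t @^-1` (~` S)); split.
- exact: measurable_preimage_countable.
- rewrite -preimage_setC probability_setC; last exact: measurable_preimage_countable.
  by rewrite (mc_states mc)// subee.
- by [].
Qed.

Lemma chain_start x : S x -> \forall w \ae (P x), xi 0%N w = x.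
Proof.
move=> Sx; exists (xi 0%N @^-1` (~` [set x])); split.
- exact: measurable_preimage_countable.
- rewrite -preimage_setC probability_setC; last exact: mxi.
  by have := mc_start mc Sx; rewrite /at_time => ->; rewrite subee.
- by [].
Qed.

Lemma markov_path x n s phi : S x -> (forall y, 0 <= phi y)%E ->
  (\int[P x]_(w in path_upto xi n s) phi (xi n.+1 w) =
   P x (path_upto xi n s) * \int[P (s n)]_w phi (xi 1%N w))%E.
Proof.
move=> Sx phi0; have mB := measurable_path_upto n s.
have fB : P x (path_upto xi n s) \is a fin_num by exact: fin_num_measure.
rewrite -[X in (X * _)%E]fineK//; apply: eq_ge0_integral_fibers => // y.
rewrite fineK// setTI.
(* The Markov property is given only along paths of positive probability; along a null path both
   sides vanish. *)
have [B0|B0] := eqVneq (P x (path_upto xi n s)) 0%E.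
  rewrite B0 mul0e; apply/eqP; rewrite -measure_le0 -B0.
  by apply: le_measure; rewrite ?inE//; do ?[exact: measurableI|exact: subIsetl].
have Bgt : (0 < P x (path_upto xi n s))%E by rewrite lt0e B0 measure_ge0.
(* [mc_markov] reads past and target off a single sequence; changing [s] at [n.+1] sets the target
   to [y] and leaves the past event unchanged. *)
pose s' i := if i == n.+1 then y else s i.
have E : path_upto xi n s' = path_upto xi n s.
  by apply/seteqP; split=> w /= H i it; have := H i it; rewrite /s' ltn_eqF.
have := @mc_markov _ _ _ _ _ _ _ mc x n s' Sx; rewrite E => /(_ Bgt).
rewrite /s' eqxx ltn_eqF// /cprob /at_time => EB.
change (P x (path_upto xi n s `&` [set w | xi n.+1 w = y]) =
  P x (path_upto xi n s) * P (s n) [set w | xi 1%N w = y])%E.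
by rewrite -EB muleC -muleA [((P x (path_upto _ _ _))^-1 * _)%E]muleC divee// mule1 setIC.
Qed.

(* Only the last step is conditioned on the past, so no shift of the path space is
   needed. *)
Lemma markov_step x n W (phi : V -> V -> \bar R) : S x ->
  (forall y z, 0 <= phi y z)%E ->
  (\int[P x]_(w in in_before W n.+1) phi (xi n w) (xi n.+1 w) =
   \int[P x]_(w in in_before W n.+1) \int[P (xi n w)]_w' phi (xi n w) (xi 1%N w'))%E.
Proof.
move=> Sx phi0; have mD := measurable_in_before W n.+1.
(* The past up to time [n] as a finite list, hence with countably many values; on each of its fibres
   [in_before W n.+1] either holds throughout or fails throughout. *)
pose f w := [seq xi i w | i <- iota 0 n.+1].
have fE w l : f w = l <-> size l = n.+1 /\ path_upto xi n (nth 0 l) w.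
  split=> [<-|[ln lw]].
    split; first by rewrite size_map size_iota.
    move=> i it; rewrite (nth_map 0%N) ?size_iota// nth_iota//.
  apply: (@eq_from_nth _ 0); first by rewrite size_map size_iota.
  move=> i; rewrite size_map size_iota => it.
  by rewrite (nth_map 0%N) ?size_iota// nth_iota// add0n lw.
have fI l : f @^-1` [set l] =
    if size l == n.+1 then path_upto xi n (nth 0 l) else set0.
  apply/seteqP; split=> w /=; first by move/fE => [-> ?]; rewrite eqxx.
  by case: eqP => // ls lw; apply/fE.
have mf l : measurable (f @^-1` [set l]).
  by rewrite fI; case: ifP => // _; exact: measurable_path_upto.
apply: (@eq_ge0_integral_partition _ _ _ _ f) => //.
- exact: measurable_chain2.
- exact: (@measurable_chain _ _ n _ (fun y => \int[P y]_w' phi y (xi 1%N w'))%E).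
- by move=> w; exact: integral_ge0.
move=> l; rewrite fI; case: eqP => [ls|_]; last by rewrite setI0 !integral_set0.
have [lW|lW] := pselect (forall i, (i < n.+1)%N -> W (nth 0 l i)); last first.
  suff -> : in_before W n.+1 `&` path_upto xi n (nth 0 l) = set0 by rewrite !integral_set0.
  rewrite -subset0 => w [/= wW wl]; apply: lW => i it.
  by rewrite -wl//; exact: wW.
have -> : in_before W n.+1 `&` path_upto xi n (nth 0 l) = path_upto xi n (nth 0 l).
  by apply/setIidr => w wl i it; rewrite wl//; exact: lW.
transitivity (\int[P x]_(w in path_upto xi n (nth 0%R l)) phi (nth 0%R l n) (xi n.+1 w))%E.
  by apply: eq_integral => w /set_mem ->.
rewrite markov_path//.
rewrite muleC -integral_cst; last exact: measurable_path_upto.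
by apply: eq_integral => w /set_mem ->.
Qed.

(** The transition kernel killed outside [W]; [step setT] is the kernel without killing. *)
Definition step W phi x : \bar R :=
  if `[< W x >] then (\int[P x]_w phi (xi 1%N w))%E else 0%E.

Lemma step_ge0 W phi : (forall y, 0 <= phi y)%E -> forall x, (0 <= step W phi x)%E.
Proof. by move=> phi0 x; rewrite /step; case: ifP => // _; exact: integral_ge0. Qed.

Lemma iter_step_ge0 W phi n : (forall y, 0 <= phi y)%E ->
  forall x, (0 <= iter n (step W) phi x)%E.
Proof. by move=> phi0; elim: n => // n IH x; exact: step_ge0. Qed.

(** The induction peels off the last step and absorbs it into [phi], which is therefore kept
    general. *)
Lemma integral_in_before x W n phi : S x -> (forall y, 0 <= phi y)%E ->
  (\int[P x]_(w in in_before W n) phi (xi n w) = iter n (step W) phi x)%E.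
Proof.
move=> Sx; elim: n phi => [|n IH] phi phi0.
  have -> : in_before W 0 = setT by apply/seteqP; split.
  transitivity (\int[P x]_w cst (phi x) w)%E; last first.
    rewrite integral_cst// -[RHS]mule1; congr (_ * _)%E; exact: probability_setT.
  apply: ge0_ae_eq_integral => //; [exact: measurable_chain|by move=> w _; exact: phi0|].
  by move: (chain_start Sx); apply: filterS => w /= ->.
rewrite (@markov_step x n W (fun _ => phi))// iterSr -IH; last exact: step_ge0.
rewrite integral_mkcond [RHS]integral_mkcond; apply: eq_integral => w _.
rewrite /patch; case: ifPn => [/set_mem wn|wn].
  rewrite ifT; last by apply/mem_set => i it; apply: wn; exact: ltnW.
  by rewrite /step; have -> : `[< W (xi n w) >] = true by apply/asboolP; exact: wn.
case: ifPn => // /set_mem wn'; rewrite /step; case: asboolP => // Wn.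
move/negP: wn; case; apply/mem_set => i; rewrite ltnS leq_eqVlt => /predU1P[->//|].
exact: wn'.
Qed.

Lemma integral_chain x n phi : S x -> (forall y, 0 <= phi y)%E ->
  (\int[P x]_w phi (xi n w) = iter n (step setT) phi x)%E.
Proof.
move=> Sx phi0; rewrite -integral_in_before//; congr (integral _ _ _).
by apply/seteqP; split.
Qed.

Lemma chain_tower x n (phi : V -> V -> \bar R) : S x ->
  (forall y z, 0 <= phi y z)%E ->
  (\int[P x]_w phi (xi n w) (xi n.+1 w) =
   \int[P x]_w \int[P (xi n w)]_w' phi (xi n w) (xi 1%N w'))%E.
Proof.
move=> Sx phi0; have := @markov_step x n setT phi Sx phi0.
by have -> : in_before setT n.+1 = setT by apply/seteqP; split.
Qed.

Lemma le_integral_chain x n phi psi : S x ->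
  (forall y, 0 <= phi y)%E -> (forall y, 0 <= psi y)%E ->
  (forall y, S y -> phi y <= psi y)%E ->
  (\int[P x]_w phi (xi n w) <= \int[P x]_w psi (xi n w))%E.
Proof.
move=> Sx phi0 psi0 le; apply: ae_ge0_le_integral => //.
- exact: measurable_chain.
- exact: measurable_chain.
- by move: (chain_in_states n Sx); apply: filterS => w Sw _; exact: le.
Qed.

Lemma le_step W phi psi x : S x ->
  (forall y, 0 <= phi y)%E -> (forall y, 0 <= psi y)%E ->
  (forall y, S y -> phi y <= psi y)%E -> (step W phi x <= step W psi x)%E.
Proof.
move=> Sx phi0 psi0 le; rewrite /step; case: ifP => // _.
exact: le_integral_chain.
Qed.

(** For starting points in [S], the probability of being in [W] at the times 0, ..., n - 1 (see
    [in_before_survive]). As an iterate, it satisfies the one-step recursion by definition. *)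
Definition survive W n : V -> \bar R := iter n (step W) (cst 1%E).

Lemma surviveS W n : survive W n.+1 = step W (survive W n).
Proof. by []. Qed.

Lemma survive_ge0 W n x : (0 <= survive W n x)%E.
Proof. by apply: iter_step_ge0 => y; exact: lee01. Qed.

Lemma survive_le1 W n x : (survive W n x <= 1)%E.
Proof.
elim: n x => [|n IH] x; first exact: lexx.
rewrite surviveS /step; case: ifP => // _.
apply: (@le_trans _ _ (\int[P x]_w cst 1 w)%E).
  apply: ge0_le_integral => //; first by move=> w _; exact: survive_ge0.
  exact: measurable_chain.
by rewrite integral_cst// mul1e; exact: probability_le1.
Qed.

Lemma survive_decr W x : {homo survive W ^~ x : n m / (n <= m)%N >-> (m <= n)%E}.
Proof.
apply/nonincreasing_seqP => n; elim: n x => [|n IH] x; first exact: survive_le1.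
rewrite (surviveS W n.+1) [in leRHS]surviveS /step; case: ifP => // _; apply: ge0_le_integral => //.
- by move=> w _; exact: survive_ge0.
- exact: measurable_chain.
- exact: measurable_chain.
Qed.

Definition survive_ever W x : \bar R := ereal_inf (range (survive W ^~ x)).

Lemma survive_ever_ge0 W x : (0 <= survive_ever W x)%E.
Proof. by apply: le_ereal_inf_tmp => _ [n _ <-]; exact: survive_ge0. Qed.

Lemma survive_ever_le W n x : (survive_ever W x <= survive W n x)%E.
Proof. by apply: ge_ereal_inf; exists (survive W n x) => //; exists n. Qed.

Lemma survive_ever_le1 W x : (survive_ever W x <= 1)%E.
Proof. exact: le_trans (survive_ever_le W 0 x) (survive_le1 _ _ _). Qed.

(** Let n tend to infinity in the recursion for [survive]: the sequence decreases to its infimum and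
    is dominated by 1. *)
Lemma survive_ever_step W x : (survive_ever W x <= step W (survive_ever W) x)%E.
Proof.
have [Wx|Wx] := boolP `[< W x >]; last first.
  by apply: le_trans (survive_ever_le W 1 x) _; rewrite /survive /= /step (negPf Wx).
rewrite /step Wx.
have cvx : (fun n => \int[P x]_w survive W n (xi 1%N w))%E @ \oo -->
    (\int[P x]_w survive_ever W (xi 1%N w))%E.
  have := @dominated_convergence _ _ _ (P x) setT measurableT
    (fun n w => survive W n (xi 1%N w)) (fun w => survive_ever W (xi 1%N w)) (cst 1%E).
  case=> //.
  - by move=> n; exact: measurable_chain.
  - exact: measurable_chain.
  - apply: aeW => w _; apply: ereal_nonincreasing_cvgn; exact: survive_decr.
  - exact: finite_measure_integrable_cst.
  - by apply: aeW => w n _; rewrite gee0_abs ?survive_ge0// survive_le1.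
apply: (cvge_ge _ cvx); near=> n.
by apply: le_trans (survive_ever_le W n.+1 x) _; rewrite surviveS /step Wx.
Unshelve. all: by end_near. Qed.

(** Removing the killing only increases the integral, so [survive_ever W] is subharmonic for the
    full kernel, and by monotonicity for its iterates. *)
Lemma survive_ever_chain W x n : S x ->
  (survive_ever W x <= \int[P x]_w survive_ever W (xi n w))%E.
Proof.
have g0 := survive_ever_ge0 W.
move=> Sx; rewrite integral_chain//; elim: n x Sx => // n IH x Sx.
apply: le_trans (survive_ever_step W x) _; rewrite iterS.
apply: (@le_trans _ _ (step setT (survive_ever W) x)).
  rewrite /step; case: ifP => _; first by rewrite asboolT.
  by case: ifP => // _; exact: integral_ge0.
apply: le_step => //; exact: iter_step_ge0.
Qed.

(* From g <= p and g = 1_W E[g], induction gives g <= p survive_n, so g <= p g. *)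
Lemma survive_ever_eq0 W (p : R) : 0 < p < 1 ->
  (forall x, S x -> survive_ever W x <= p%:E)%E ->
  forall x, S x -> survive_ever W x = 0%E.
Proof.
move=> /andP[p0 p1] gp.
have gpn n x : S x -> (survive_ever W x <= p%:E * survive W n x)%E.
  elim: n x => [|n IH] x Sx; first by rewrite mule1; exact: gp.
  apply: le_trans (survive_ever_step W x) _.
  apply: (@le_trans _ _ (step W (fun y => p%:E * survive W n y)%E x)).
    apply: le_step => //; first exact: survive_ever_ge0.
    by move=> y; rewrite mule_ge0 ?survive_ge0// lee_fin ltW.
  rewrite surviveS /step; case: ifP => _; last by rewrite mule0.
  rewrite ge0_integralZl_EFin//; [|exact: measurable_chain|exact: ltW].
  by move=> w _; exact: survive_ge0.
move=> x Sx; have g0 := survive_ever_ge0 W x; have g1 := survive_ever_le1 W x.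
have fg : survive_ever W x \is a fin_num by rewrite ge0_fin_numE// (le_lt_trans g1)// ltry.
(* By [gpn], g / p is a lower bound of every [survive W n x], hence of their infimum g; as p < 1
   this forces g <= 0. *)
have : (survive_ever W x * (p^-1)%:E <= survive_ever W x)%E.
  apply: le_ereal_inf_tmp => _ [n _ <-]; rewrite lee_pdivrMr//.
  by rewrite muleC; exact: gpn.
rewrite lee_pdivrMr// -(fineK fg) -EFinM lee_fin => le.
apply/eqP; rewrite eqe eq_le -[X in _ && X]lee_fin fineK// g0 andbT.
have : 0 <= (1 - p) * - fine (survive_ever W x) by rewrite mulrBl mul1r; lra.
by rewrite pmulr_rge0 ?subr_gt0// oppr_ge0.
Qed.

Lemma in_before_survive W n x : S x -> P x (in_before W n) = survive W n x.
Proof.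
move=> Sx; rewrite /survive -integral_in_before//.
rewrite -[RHS]/(\int[P x]_(w in in_before W n) cst 1 w)%E integral_cst ?mul1e//.
exact: measurable_in_before.
Qed.

Lemma stay_forever_le W x : S x ->
  (P x (\bigcap_n in_before W n) <= survive_ever W x)%E.
Proof.
move=> Sx; apply: le_ereal_inf_tmp => _ [n _ <-]; rewrite -in_before_survive//.
apply: le_measure; rewrite ?inE; [|exact: measurable_in_before|].
  by apply: bigcap_measurable => // k _; exact: measurable_in_before.
by move=> w; apply.
Qed.

End Chain.

(** * Euclidean norm *)

Section EuclideanNorm.
Context {R : realType} {d : nat}.
Implicit Types (u v w x y : 'rV[R]_d) (a : R).

Lemma dotC u v : dot u v = dot v u.
Proof. by apply: eq_bigr => i _; rewrite mulrC. Qed.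

Lemma dotDl u v w : dot (u + v) w = dot u w + dot v w.
Proof. by rewrite /dot -big_split; apply: eq_bigr => i _; rewrite mxE mulrDl. Qed.

Lemma dotZl a u v : dot (a *: u) v = a * dot u v.
Proof. by rewrite /dot mulr_sumr; apply: eq_bigr => i _; rewrite mxE mulrA. Qed.

Lemma dotDr u v w : dot w (u + v) = dot w u + dot w v.
Proof. by rewrite dotC dotDl !(dotC w). Qed.

Lemma dotZr a u v : dot u (a *: v) = a * dot u v.
Proof. by rewrite dotC dotZl dotC. Qed.

Lemma dotNl u v : dot (- u) v = - dot u v.
Proof. by rewrite -scaleN1r dotZl mulN1r. Qed.

Lemma dotNr u v : dot u (- v) = - dot u v.
Proof. by rewrite dotC dotNl dotC. Qed.

Definition dotE := (dotDl, dotDr, dotZl, dotZr, dotNl, dotNr).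

Lemma dot_ge0 x : 0 <= dot x x.
Proof. by apply: sumr_ge0 => i _; rewrite -expr2 sqr_ge0. Qed.

Lemma dot_eq0 x : dot x x = 0 -> x = 0.
Proof.
move=> x0; apply/rowP => i; rewrite mxE; apply/eqP.
rewrite -sqrf_eq0 eq_le sqr_ge0 andbT -x0 /dot (bigD1 i)//= expr2 lerDl.
by apply: sumr_ge0 => j _; rewrite -expr2 sqr_ge0.
Qed.

Lemma enorm_ge0 x : 0 <= enorm x. Proof. exact: sqrtr_ge0. Qed.

Lemma enorm_sqr x : enorm x ^+ 2 = dot x x.
Proof. by rewrite sqr_sqrtr// dot_ge0. Qed.

Lemma enorm_eq0 x : enorm x = 0 -> x = 0.
Proof. by move=> x0; apply: dot_eq0; rewrite -enorm_sqr x0 expr0n. Qed.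

Lemma enormZ a x : enorm (a *: x) = `|a| * enorm x.
Proof. by rewrite /enorm dotZl dotZr mulrA -expr2 sqrtrM ?sqr_ge0// sqrtr_sqr. Qed.

Lemma enormN x : enorm (- x) = enorm x.
Proof. by rewrite -scaleN1r enormZ normrN1 mul1r. Qed.

Lemma enormB x y : enorm (x - y) = enorm (y - x).
Proof. by rewrite -enormN opprB. Qed.

Lemma cauchy_schwarz u v : dot u v <= enorm u * enorm v.
Proof.
have [u0|u0] := eqVneq (dot u u) 0.
  by rewrite (dot_eq0 u0) -(scale0r (0 : 'rV[R]_d)) dotZl enormZ normr0 !mul0r.
have up : 0 < dot u u by rewrite lt0r u0 dot_ge0.
(* This vector is |u|^2 times the component of [v] orthogonal to [u]. *)
have := dot_ge0 (dot u u *: v - dot u v *: u).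
rewrite !dotE (dotC v u) => h.
have : 0 <= dot u u * (dot u u * dot v v - dot u v ^+ 2).
  by apply: le_trans h _; rewrite le_eqVlt; apply/orP; left; apply/eqP; ring.
rewrite pmulr_rge0// subr_ge0 -!enorm_sqr -exprMn => h'.
rewrite leNgt; apply/negP => lt.
have := h'; rewrite leNgt ltr_pXn2r ?nnegrE//; first by rewrite lt.
  by rewrite mulr_ge0 ?enorm_ge0.
by apply: ltW; apply: le_lt_trans lt; rewrite mulr_ge0 ?enorm_ge0.
Qed.

Lemma enormD x y : enorm (x + y) <= enorm x + enorm y.
Proof.
rewrite -(@ler_pXn2r _ 2)// ?nnegrE ?addr_ge0 ?enorm_ge0//.
rewrite enorm_sqr !dotE (dotC y x) sqrrD !enorm_sqr.
have := cauchy_schwarz x y; lra.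
Qed.

Lemma enorm_distl x y : enorm x - enorm y <= enorm (x - y).
Proof. by rewrite lerBlDr -[X in enorm X <= _](subrK y); exact: enormD. Qed.

Lemma enorm_coord x i : `|x 0 i| <= enorm x.
Proof.
rewrite -(@ler_pXn2r _ 2)// ?nnegrE ?enorm_ge0// real_normK ?num_real//.
rewrite enorm_sqr /dot (bigD1 i)//= expr2 lerDl.
by apply: sumr_ge0 => j _; rewrite -expr2 sqr_ge0.
Qed.

Lemma enorm_max_coord x : (0 < d)%N ->
  exists i, enorm x ^+ 2 <= d%:R * x 0 i ^+ 2.
Proof.
move=> d0; pose i0 := Ordinal d0.
exists [arg max_(i > i0) x 0 i ^+ 2]%O; case: arg_maxP => //= i _ H.
rewrite enorm_sqr /dot -[d in d%:R]card_ord mulr_natl -sumr_const.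
by apply: ler_sum => j _; rewrite -expr2; exact: H.
Qed.

(** By the parallelogram law the difference of the two sides is |x - y|^2. *)
Lemma enorm_sqrD_le x y : enorm (x + y) ^+ 2 <= 2 * enorm x ^+ 2 + 2 * enorm y ^+ 2.
Proof.
have := dot_ge0 (x - y); rewrite !enorm_sqr !dotE (dotC y x); lra.
Qed.

End EuclideanNorm.

Section IntegerPoints.
Context {R : realType} {d : nat}.
Implicit Types x y : 'rV[int]_d.

Lemma toRD x y : toR (x + y) = toR x + toR y :> 'rV[R]_d.
Proof. exact: map_mxD. Qed.

Lemma toRB x y : toR (x - y) = toR x - toR y :> 'rV[R]_d.
Proof. exact: map_mxB. Qed.

Lemma toR_delta (k : nat) i :
  toR (k%:Z *: delta_mx 0 i) = k%:R *: delta_mx 0 i :> 'rV[R]_d.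
Proof. by rewrite /toR map_mxZ map_delta_mx. Qed.

Lemma dot_delta (v : 'rV[R]_d) i : dot v (delta_mx 0 i) = v 0 i.
Proof.
rewrite /dot (bigD1 i)//= big1 ?addr0 => [|j ji]; rewrite mxE eqxx ?eqxx ?mulr1//.
by rewrite (negPf ji) mulr0.
Qed.

End IntegerPoints.

(** * Growth of the mean squared distance *)

Section Moments.
Context {R : realType} {disp : measure_display} {T : measurableType disp}.
Context {d : nat} {S : set 'rV[int]_d} (P : 'rV[int]_d -> probability T R).
Context (xi : nat -> T -> 'rV[int]_d) (mc : markov_chain S P xi).
Local Notation V := 'rV[int]_d.
Implicit Types (x y z : V) (a : 'rV[R]_d) (phi psi : V -> R).

Definition mean n x phi : \bar R := (\int[P x]_w (phi (xi n w))%:E)%E.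

Definition sqdist a z : R := enorm (toR z - a) ^+ 2.

Lemma sqdist_ge0 a z : 0 <= sqdist a z. Proof. exact: sqr_ge0. Qed.

Lemma measurable_chain_EFin t D phi : measurable_fun D (fun w => (phi (xi t w))%:E).
Proof. exact: (@measurable_chain _ _ _ _ _ _ _ mc _ _ t D (EFin \o phi)). Qed.

Lemma mean_ge0 n x phi : (forall y, 0 <= phi y) -> (0 <= mean n x phi)%E.
Proof. by move=> phi0; apply: integral_ge0 => w _; rewrite lee_fin. Qed.

Lemma mean_le n x phi psi : S x ->
  (forall y, 0 <= phi y) -> (forall y, 0 <= psi y) ->
  (forall y, S y -> phi y <= psi y) -> (mean n x phi <= mean n x psi)%E.
Proof.
move=> Sx phi0 psi0 le.
by apply: (@le_integral_chain _ _ _ _ _ _ _ mc x n (EFin \o phi) (EFin \o psi)) => // y *;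
  rewrite lee_fin ?le.
Qed.

Lemma mean_cst n x (c : R) : mean n x (cst c) = c%:E.
Proof.
rewrite /mean -[LHS]/(\int[P x]_w cst c%:E w)%E integral_cst// -[RHS]mule1.
by congr (_ * _)%E; exact: probability_setT.
Qed.

Lemma meanD n x phi psi : (forall y, 0 <= phi y) -> (forall y, 0 <= psi y) ->
  mean n x (fun y => phi y + psi y) = (mean n x phi + mean n x psi)%E.
Proof.
move=> phi0 psi0; rewrite /mean -ge0_integralD//.
- by move=> w _; rewrite lee_fin.
- exact: measurable_chain_EFin.
- by move=> w _; rewrite lee_fin.
- exact: measurable_chain_EFin.
Qed.

Lemma meanZ n x (c : R) phi : 0 <= c -> (forall y, 0 <= phi y) ->
  mean n x (fun y => c * phi y) = (c%:E * mean n x phi)%E.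
Proof.
move=> c0 phi0; rewrite /mean -ge0_integralZl_EFin//.
  by move=> w _; rewrite lee_fin.
exact: measurable_chain_EFin.
Qed.

Lemma mean_affine n x (c c' : R) phi : 0 <= c -> 0 <= c' ->
  (forall y, 0 <= phi y) ->
  mean n x (fun y => c + c' * phi y) = (c%:E + c'%:E * mean n x phi)%E.
Proof.
move=> c0 c'0 phi0; rewrite (@meanD n x (cst c) (fun y => c' * phi y)).
- by rewrite mean_cst meanZ.
- by [].
- by move=> y; rewrite mulr_ge0.
Qed.

Lemma mean_le_affine n x phi psi (c c' m : R) : S x ->
  0 <= c -> 0 <= c' -> (forall y, 0 <= phi y) -> (forall y, 0 <= psi y) ->
  (forall y, S y -> psi y <= c + c' * phi y) ->
  (mean n x phi <= m%:E)%E -> (mean n x psi <= (c + c' * m)%:E)%E.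
Proof.
move=> Sx c0 c'0 phi0 psi0 le lem.
apply: (@le_trans _ _ (mean n x (fun y => c + c' * phi y))).
  by apply: mean_le => // y; rewrite addr_ge0 ?mulr_ge0.
rewrite mean_affine// EFinD EFinM leeD2l// lee_wpmul2l//.
Qed.

(** Condition on [xi n]: a one-step bound affine in [phi] is averaged over the position at time
    [n]. *)
Lemma mean_succ_le_affine n x phi psi (c c' m : R) : S x ->
  0 <= c -> 0 <= c' -> (forall y, 0 <= phi y) -> (forall y, 0 <= psi y) ->
  (forall y, S y -> mean 1 y psi <= (c + c' * phi y)%:E)%E ->
  (mean n x phi <= m%:E)%E -> (mean n.+1 x psi <= (c + c' * m)%:E)%E.
Proof.
move=> Sx c0 c'0 phi0 psi0 le lem.
rewrite /mean (@chain_tower _ _ _ _ _ _ _ mc x n (fun _ y => (psi y)%:E))//.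
apply: (@le_trans _ _ (mean n x (fun y => c + c' * phi y))).
  apply: (@le_integral_chain _ _ _ _ _ _ _ mc x n (mean 1 ^~ psi)
    (fun y => (c + c' * phi y)%:E)) => //.
  - by move=> y; exact: mean_ge0.
  - by move=> y; rewrite lee_fin addr_ge0 ?mulr_ge0.
rewrite mean_affine// EFinD EFinM leeD2l// lee_wpmul2l//.
Qed.

Lemma mean0 x phi : S x -> (forall y, 0 <= phi y) -> mean 0 x phi = (phi x)%:E.
Proof.
by move=> Sx phi0; rewrite /mean (@integral_chain _ _ _ _ _ _ _ mc x 0 (EFin \o phi)).
Qed.

Context {B0 : R} (B0_ge0 : 0 <= B0).
Hypothesis step_moment2 : forall x, S x -> (mean 1 x (sqdist (toR x)) <= B0%:E)%E.

(** By induction from |z - x|^2 <= 2 |y - x|^2 + 2 |z - y|^2, with y and z the positions at times n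
    and n + 1. *)
Lemma moment2 n : exists2 c : R, 0 <= c &
  forall x, S x -> (mean n x (sqdist (toR x)) <= c%:E)%E.
Proof.
elim: n => [|n [c c0 IH]].
  exists 0 => // x Sx; rewrite mean0//; last exact: sqdist_ge0.
  by rewrite lee_fin /sqdist subrr enorm_sqr -(scale0r (0 : 'rV[R]_d)) dotZl mul0r.
exists (2 * B0 + 2 * c) => [|x Sx]; first by rewrite addr_ge0 ?mulr_ge0.
apply: (@mean_succ_le_affine n x (sqdist (toR x))); rewrite ?mulr_ge0//; last exact: IH.
1,2: exact: sqdist_ge0.
move=> y Sy; rewrite addrC.
apply: (@mean_le_affine 1 y (sqdist (toR y))); rewrite ?mulr_ge0 ?enorm_ge0//.
- exact: sqdist_ge0.
- exact: sqdist_ge0.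
- move=> z _; apply: le_trans (enorm_sqrD_le _ _).
  by rewrite /sqdist [toR y - _ + _]addrC subrKA.
- exact: step_moment2.
Qed.

(** Holds without any control of the drift: the cross term is bounded by 2 e f <= e (1 + f^2), where
    f is the length of the jump. *)
Lemma sqdist_step_crude y a : S y ->
  (mean 1 y (sqdist a) <=
   (enorm (toR y - a) ^+ 2 + enorm (toR y - a) * (1 + B0) + B0)%:E)%E.
Proof.
move=> Sy; set e := enorm (toR y - a); have e0 : 0 <= e by exact: enorm_ge0.
have -> : e ^+ 2 + e * (1 + B0) + B0 = (e ^+ 2 + e) + (e + 1) * B0 by ring.
apply: (@mean_le_affine 1 y (sqdist (toR y))); rewrite ?addr_ge0 ?sqr_ge0//.
- exact: sqdist_ge0.
- exact: sqdist_ge0.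
- move=> z _; rewrite /sqdist.
  have := enormD (toR z - toR y) (toR y - a); rewrite subrKA -/e.
  set f := enorm (toR z - toR y) => le.
  have f0 : 0 <= f by exact: enorm_ge0.
  have : enorm (toR z - a) ^+ 2 <= (f + e) ^+ 2.
    by rewrite ler_pXn2r// nnegrE ?addr_ge0 ?enorm_ge0//.
  have := mulr_ge0 e0 (sqr_ge0 (f - 1)); lra.
- exact: step_moment2.
Qed.

(** Expand |v + D|^2 with D the increment and integrate. The linear term is integrable because |D i|
    <= 1 + |D|^2. *)
Lemma sqdist_step_drift y a : S y ->
  mean 1 y (sqdist a) =
   ((enorm (toR y - a) ^+ 2 + 2 * dot (toR y - a) (mean_drift P xi y))%:E +
    mean 1 y (sqdist (toR y)))%E.
Proof.
move=> Sy; set v := toR y - a.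
pose D i w : R := (toR (xi 1%N w) - toR y) 0 i.
have iF : (P y).-integrable setT (fun w => (sqdist (toR y) (xi 1%N w))%:E).
  apply/integrableP; split; first exact: measurable_chain_EFin.
  under eq_integral => w _ do rewrite gee0_abs ?lee_fin ?sqdist_ge0//.
  by rewrite (le_lt_trans (step_moment2 Sy))// ltry.
have icst (c : R) : (P y).-integrable setT (cst c%:E).
  exact: (finite_measure_integrable_cst (P y) c measurableT).
have iD i : (P y).-integrable setT (fun w => (D i w)%:E).
  apply: (@le_integrable _ _ _ _ _ measurableT _
    (fun w => (1 + sqdist (toR y) (xi 1%N w))%:E)).
  - by have := @measurable_chain_EFin 1 setT (fun z => (toR z - toR y) 0 i).
  - move=> w _; rewrite lee_fin [leRHS]ger0_norm ?addr_ge0 ?sqdist_ge0//.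
    apply: le_trans (enorm_coord _ i) _; rewrite /sqdist.
    set e := enorm _; have := sqr_ge0 (e - 1).
    have : 0 <= e by exact: enorm_ge0.
    nra.
  - exact: (integrableD measurableT (icst 1) iF).
have muE i : (\int[P y]_w (D i w)%:E = (mean_drift P xi y 0 i)%:E)%E.
  have DE : ('E_(P y)[fun w => (toR (xi 1%N w - xi 0%N w) 0 i)%R] = \int[P y]_w (D i w)%:E)%E.
    rewrite unlock; apply: ae_eq_integral => //.
    - by have := @measurable_chain2 _ _ _ _ _ _ _ mc _ _ 1 0 setT
        (fun z x => (toR (z - x) 0 i : R)%:E).
    - by have := @measurable_chain_EFin 1 setT (fun z => (toR z - toR y) 0 i).
    - by move: (chain_start mc Sy); apply: filterS => w w0 _; rewrite w0 toRB.
  by rewrite mxE DE fineK// integrable_fin_num.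
have iS : (P y).-integrable setT (fun w => \sum_(i < d) (v 0%R i)%:E * (D i w)%:E)%E.
  by apply: integrable_sum => // i _; exact: integrableZl.
transitivity (\int[P y]_w ((cst (enorm v ^+ 2)%:E w +
  2%:E * \sum_(i < d) (v 0%R i)%:E * (D i w)%:E) + (sqdist (toR y) (xi 1%N w))%:E))%E.
  apply: eq_integral => w _; rewrite /sqdist.
  have -> : toR (xi 1%N w) - a = v + (toR (xi 1%N w) - toR y).
    by rewrite /v [RHS]addrC subrKA.
  under eq_bigr do rewrite -EFinM.
  rewrite sumEFin -EFinM -!EFinD; congr (_%:E).
  rewrite -[\sum_(i < d) _]/(dot v (toR (xi 1%N w) - toR y)).
  move: (v) (toR _ - toR y) => p q; rewrite !enorm_sqr !dotE (dotC q p); ring.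
have iZ : (P y).-integrable setT (fun w => 2%:E * \sum_(i < d) (v 0%R i)%:E * (D i w)%:E)%E.
  exact: integrableZl.
rewrite integralD//; last exact: integrableD.
rewrite integralD// integralZl// integral_sum//; last by move=> i; exact: integrableZl.
rewrite integral_cst// [X in (_ * X)%E]probability_setT mule1.
under eq_bigr => i _ do rewrite integralZl// muE -EFinM.
by rewrite sumEFin -EFinM -EFinD.
Qed.

Context {C r0 : R}.
Hypothesis drift_bound : forall x, S x -> r0 <= enorm (toR x : 'rV[R]_d) ->
  enorm (mean_drift P xi x) <= C * (enorm (toR x))^-1.

(* Near the origin the drift is uncontrolled, but such a y is far from x, so the
   error is absorbed in the multiple of |y - x|^2. *)
Lemma sqdist_step : exists C1 C2 R0 : R, [/\ 0 <= C1, 0 <= C2 &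
  forall r x a y, R0 <= r -> r / 8 <= enorm (toR x : 'rV[R]_d) ->
    enorm a <= 2 * r -> S y ->
    (mean 1 y (sqdist a) <=
      (C1 + (sqdist a y + C2 * sqdist (toR x) y))%:E)%E].
Proof.
(* If |y| >= r / 16, then |y - a| <= 33 |y| and the drift term is at most 2 * 33 |C|. Otherwise |y -
   x| >= r / 16, so r <= r^2 <= 256 |y - x|^2, and |y - a| <= 3 r gives 768 = 3 * 256. The threshold
   on r ensures r >= 1 and r / 16 >= r0. *)
exists (66 * `|C| + B0), (768 * (1 + B0)), (1 + 16 * `|r0|); split.
- by rewrite addr_ge0 ?mulr_ge0 ?normr_ge0.
- by rewrite mulr_ge0 ?addr_ge0 ?normr_ge0.
move=> r x a y hr hx ha Sy.
have r1 : 1 <= r by apply: le_trans hr; rewrite lerDl mulr_ge0.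
have rr0 : r0 <= r / 16 by have := ler_norm r0; lra.
have he : enorm (toR y - a) <= enorm (toR y : 'rV[R]_d) + 2 * r.
  by apply: le_trans (enormD _ _) _; rewrite enormN lerD2l.
have q0 : 0 <= sqdist (toR x) y by exact: sqdist_ge0.
have C0 : 0 <= `|C| by [].
have [yr|yr] := leP (r / 16) (enorm (toR y : 'rV[R]_d)); last first.
  apply: le_trans (sqdist_step_crude a Sy) _; rewrite lee_fin /sqdist.
  have hq : r / 16 <= enorm (toR y - toR x : 'rV[R]_d).
    by have := enorm_distl (toR x : 'rV[R]_d) (toR y); rewrite enormB; lra.
  have hq2 : r * 1 <= 256 * enorm (toR y - toR x : 'rV[R]_d) ^+ 2.
    apply: (@le_trans _ _ (r * r)); first by rewrite ler_wpM2l//; lra.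
    have : (r / 16) ^+ 2 <= enorm (toR y - toR x : 'rV[R]_d) ^+ 2.
      by rewrite ler_pXn2r// nnegrE ?enorm_ge0//; lra.
    lra.
  have : enorm (toR y - a) * (1 + B0) <= 3 * r * (1 + B0).
    by rewrite ler_wpM2r ?addr_ge0//; lra.
  have : 3 * (1 + B0) * (r * 1) <= 3 * (1 + B0) * (256 * enorm (toR y - toR x : 'rV[R]_d) ^+ 2).
    by rewrite ler_wpM2l// mulr_ge0// addr_ge0.
  lra.
rewrite sqdist_step_drift//.
apply: (@le_trans _ _ ((enorm (toR y - a) ^+ 2 +
   2 * dot (toR y - a) (mean_drift P xi y))%:E + B0%:E)%E).
  by rewrite leeD2l// step_moment2.
rewrite -EFinD lee_fin /sqdist.
have y0 : 0 < enorm (toR y : 'rV[R]_d) by lra.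
have h1 := cauchy_schwarz (toR y - a) (mean_drift P xi y).
have h2 : enorm (toR y - a) * enorm (mean_drift P xi y) <= 33 * `|C|.
  apply: (@le_trans _ _ ((33 * enorm (toR y : 'rV[R]_d)) * (`|C| / enorm (toR y : 'rV[R]_d)))).
    apply: ler_pM; rewrite ?enorm_ge0//; first by lra.
    apply: le_trans (drift_bound Sy _) _; first by lra.
    by rewrite ler_wpM2r ?invr_ge0 ?enorm_ge0// ler_norm.
  rewrite le_eqVlt; apply/orP; left; apply/eqP; field; lra.
have : 0 <= 768 * (1 + B0) * enorm (toR y - toR x : 'rV[R]_d) ^+ 2.
  by apply: mulr_ge0; [rewrite mulr_ge0 ?addr_ge0|exact: sqr_ge0].
lra.
Qed.

(** Apply [sqdist_step] at the position at time n; its error C2 |y - x|^2 has a mean bounded by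
    [moment2]. Thus [L] depends on none of r, x, a. *)
Lemma sqdist_growth n : exists L R0 : R, 0 <= L /\
  forall r x a, R0 <= r -> r / 8 <= enorm (toR x : 'rV[R]_d) ->
    enorm a <= 2 * r -> S x ->
    (mean n x (sqdist a) <= (sqdist a x + L)%:E)%E.
Proof.
have [C1 [C2 [R1 [C10 C20 step1]]]] := sqdist_step.
elim: n => [|n [L [R0 [L0 IH]]]].
  exists 0, 0; split=> // r x a _ _ _ Sx.
  by rewrite mean0 ?addr0//; exact: sqdist_ge0.
have [c c0 hc] := moment2 n.
exists (C1 + L + C2 * c), (`|R0| + `|R1|); split.
  by rewrite !addr_ge0 ?mulr_ge0.
move=> r x a hr hx ha Sx.
have rR1 : R1 <= r by have := ler_norm R1; have := normr_ge0 R0; lra.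
have rR0 : R0 <= r by have := ler_norm R0; have := normr_ge0 R1; lra.
have -> : sqdist a x + (C1 + L + C2 * c) = C1 + 1 * (sqdist a x + L + C2 * c) by ring.
apply: (@mean_succ_le_affine n x (fun y => sqdist a y + C2 * sqdist (toR x) y)) => //.
- by move=> y; apply: addr_ge0; [|apply: mulr_ge0]; rewrite ?sqdist_ge0.
- exact: sqdist_ge0.
- by move=> y Sy; rewrite mul1r; exact: (step1 r).
rewrite (@meanD n x (sqdist a) (fun y => C2 * sqdist (toR x) y)); last 2 first.
- exact: sqdist_ge0.
- by move=> y; apply: mulr_ge0; rewrite ?sqdist_ge0.
rewrite (@meanZ n x C2 (sqdist (toR x)))//; last exact: sqdist_ge0.
by rewrite EFinD leeD//; [exact: (IH r)|rewrite EFinM lee_wpmul2l// hc].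
Qed.

End Moments.

(** * Gaussian comparison functions *)

(** The order of quantifiers matters: [eta] and [R0] are uniform in r, a and delta. The lower bound
    7/8 r keeps the ball B(a, 3r/4) at distance at least r / 8 from the origin. *)
Definition propagates {R : realType} {d : nat} (S : set 'rV[int]_d)
    (g : 'rV[int]_d -> R) (c : R) : Prop :=
  exists eta R0 : R, 0 < eta <= 1 /\
    forall r a delta, R0 <= r -> 7 / 8 * r <= enorm a -> enorm a <= 2 * r ->
      0 < delta <= 1 ->
      (forall y, S y -> enorm (toR y - a) <= c * r -> g y <= 1 - delta) ->
      forall x, S x -> enorm (toR x - a) <= r / 2 -> g x <= 1 - eta * delta.

Section Gaussian.
Context {R : realType} {disp : measure_display} {T : measurableType disp}.
Context {d : nat} {S : set 'rV[int]_d} (P : 'rV[int]_d -> probability T R).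
Context (xi : nat -> T -> 'rV[int]_d) (mc : markov_chain S P xi).
Local Notation V := 'rV[int]_d.
Local Notation mean := (@mean R disp T d P xi).
Implicit Types (x y z : V) (a : 'rV[R]_d).

(** Square the bound exp (s / 2) >= 1 + s / 2. *)
Lemma expR_ge_quad (s : R) : 0 <= s -> 1 + s + s ^+ 2 / 4 <= expR s.
Proof.
move=> s0; have -> : s = s / 2 + s / 2 by lra.
rewrite expRD; have h := expR_ge1Dx (s / 2).
apply: (@le_trans _ _ ((1 + s / 2) * (1 + s / 2))); first by lra.
by apply: ler_pM => //; lra.
Qed.

Lemma mean_eq n x z : mean n x (fun y => (y == z)%:R) = P x [set w | xi n w = z].
Proof.
have mA : measurable [set w | xi n w = z] by exact: (mc_measurable mc).
have := @integral_indic _ _ _ (P x) setT measurableT _ mA; rewrite setIT => <-.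
apply: eq_integral => w _; rewrite indicE.
by have [<-|wz] := eqVneq (xi n w) z; [rewrite mem_set|rewrite memNset//; exact/eqP].
Qed.

(** The supremum need not be attained, so the upper bound is improved repeatedly: where w exceeds M,
    each use of the mean inequality lowers the bound by e. *)
Lemma maximum_principle n (w : V -> R) (M e b : R) :
  (forall x, 0 <= w x) -> 0 < e -> 0 <= M ->
  (forall x, S x -> w x <= M + b) ->
  (forall x, S x -> M < w x -> ((w x + e)%:E <= mean n x w)%E) ->
  forall x, S x -> w x <= M.
Proof.
move=> w0 e0 M0 wb ws.
have H m x : S x -> w x <= M + Num.max 0 (b - m%:R * e).
  elim: m x => [|m IH] x Sx.
    by rewrite mul0r subr0; apply: le_trans (wb x Sx) _; rewrite lerD2l le_max lexx orbT.
  have [wM|Mw] := leP (w x) M.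
    by apply: le_trans wM _; rewrite lerDl le_max lexx.
  have B0 : 0 <= M + Num.max 0 (b - m%:R * e) by rewrite addr_ge0// le_max lexx.
  have : ((w x + e)%:E <= (M + Num.max 0 (b - m%:R * e))%:E)%E.
    apply: le_trans (ws x Sx Mw) _; rewrite -(@mean_cst _ _ _ _ P xi n x).
    by apply: (mean_le mc).
  rewrite lee_fin -natr1 mulrDl mul1r; move: Mw.
  by rewrite /Num.max; case: ifPn; case: ifPn; rewrite -?leNgt; lra.
move=> x Sx; have [m hm] : exists m : nat, b < m%:R * e.
  exists (Num.bound `|b / e|); rewrite -ltr_pdivrMr//.
  by apply: le_lt_trans (ler_norm _) _; exact: archi_boundP.
by have := H m x Sx; rewrite max_l ?addr0//; lra.
Qed.

Definition gauss (beta : R) a z : R := expR (- (beta * sqdist a z)).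

Lemma gauss_ge0 beta a z : 0 <= gauss beta a z. Proof. exact: expR_ge0. Qed.

Lemma gauss_le1 beta a z : 0 <= beta -> gauss beta a z <= 1.
Proof. by move=> b0; rewrite -expR0 ler_expR oppr_le0 mulr_ge0// sqdist_ge0. Qed.

Context {n k : nat} {kappa : R} (kappa_gt0 : 0 < kappa) (k_gt0 : (0 < k)%N).
Context (d_gt0 : (0 < d)%N).
Hypothesis elliptic : forall x y, S x ->
  (exists i : 'I_d, y = k%:Z *: delta_mx 0 i \/ y = - (k%:Z *: delta_mx 0 i)) ->
  (kappa%:E <= P x [set w | xi n w = (x + y)%R])%E.

(** Step along the axis of the largest coordinate v_i of x - a, against its sign: the squared
    distance changes by k^2 - 2 k |v_i|, and k <= m <= |v_i|. *)
Lemma elliptic_step x a (m : R) : k%:R <= m ->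
  m ^+ 2 * d%:R <= sqdist a x ->
  exists2 y, (exists i : 'I_d, y = k%:Z *: delta_mx 0 i \/ y = - (k%:Z *: delta_mx 0 i)) &
    sqdist a (x + y) <= sqdist a x - k%:R * m.
Proof.
move=> km mx; set v := toR x - a.
have [i hi] := enorm_max_coord v d_gt0.
have k0 : 0 <= k%:R :> R by [].
have mi : m <= `|v 0 i|.
  rewrite -(@ler_pXn2r _ 2)// ?nnegrE ?normr_ge0//; last by lra.
  rewrite real_normK ?num_real// -(@ler_pM2r _ d%:R) ?ltr0n// [leRHS]mulrC.
  exact: le_trans mx hi.
have kv : k%:R * m <= k%:R * `|v 0 i| by rewrite ler_wpM2l.
have kk : k%:R * k%:R <= k%:R * m by rewrite ler_wpM2l.
have sq (s : R) : enorm (v + s *: delta_mx 0 i) ^+ 2 = enorm v ^+ 2 + 2 * s * v 0 i + s ^+ 2.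
  move: (v) => p; rewrite !enorm_sqr !dotE (dotC _ p) !dot_delta !mxE !eqxx /=; ring.
have eqv y : sqdist a (x + y) = enorm (v + toR y) ^+ 2.
  by rewrite /sqdist toRD addrAC.
have [vi|vi] := leP 0 (v 0 i).
  exists (- (k%:Z *: delta_mx 0 i)); first by exists i; right.
  rewrite eqv (_ : toR _ = - k%:R *: delta_mx 0 i); last first.
    by rewrite scaleNr -(toR_delta k i) /toR map_mxN.
  rewrite sq /sqdist -/v; move: kv; rewrite ger0_norm//; nra.
exists (k%:Z *: delta_mx 0 i); first by exists i; left.
rewrite eqv toR_delta sq /sqdist -/v; move: kv; rewrite ltr0_norm//; nra.
Qed.

Context {L R1 : R} (L_ge0 : 0 <= L).
Hypothesis growth : forall r x a, R1 <= r -> r / 8 <= enorm (toR x : 'rV[R]_d) ->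
  enorm a <= 2 * r -> S x -> (mean n x (sqdist a) <= (sqdist a x + L)%:E)%E.

(* Convexity of exp turns the growth bound for sqdist into a lower bound for the
   mean of gauss; the elliptic step contributes the second-order term. *)
Lemma gauss_mean_ge x a (beta m : R) : S x -> 0 <= beta -> k%:R <= m ->
  m ^+ 2 * d%:R <= sqdist a x ->
  (mean n x (sqdist a) <= (sqdist a x + L)%:E)%E ->
  ((gauss beta a x * (1 + kappa * ((beta * (k%:R * m)) ^+ 2 / 4) - beta * L))%:E
    <= mean n x (gauss beta a))%E.
Proof.
move=> Sx b0 km mx NL.
have [y hy Ny] := elliptic_step km mx; have Py := elliptic Sx hy.
set G := gauss beta a x; set q := (beta * (k%:R * m)) ^+ 2 / 4.
have G0 : 0 < G by exact: expR_gt0.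
have Gn := ltW G0; have kn := ltW kappa_gt0.
have q0 : 0 <= q by rewrite divr_ge0 ?sqr_ge0.
have bN z : 0 <= beta * sqdist a z by rewrite mulr_ge0// sqdist_ge0.
have gE z : gauss beta a z = G * expR (beta * sqdist a x - beta * sqdist a z).
  by rewrite /G /gauss -expRD; congr expR; ring.
have bkm : 0 <= beta * (k%:R * m).
  by rewrite mulr_ge0// mulr_ge0// (le_trans _ km).
(* This is exp s >= 1 + s, improved by q at the elliptic neighbour, with the negative term moved
   across so that only means of non-negative functions occur. *)
have pt z : G * (1 + beta * sqdist a x) + (G * q) * (z == x + y)%:R <=
    gauss beta a z + (G * beta) * sqdist a z.
  rewrite gE; have [->|zxy] := eqVneq z (x + y).
    set s := beta * sqdist a x - beta * sqdist a (x + y).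
    have hs : beta * (k%:R * m) <= s.
      have : beta * (k%:R * m) <= beta * (sqdist a x - sqdist a (x + y)).
        by rewrite ler_wpM2l//; lra.
      by rewrite /s mulrBr.
    have s0 : 0 <= s by exact: le_trans hs.
    have : q <= s ^+ 2 / 4.
      by rewrite ler_pM2r ?invr_gt0// ler_pXn2r// nnegrE.
    have := expR_ge_quad s0 => h1 h2.
    have : G * (1 + s + q) <= G * expR s by rewrite ler_wpM2l//; lra.
    rewrite /s /= mulr1; lra.
  have := expR_ge1Dx (beta * sqdist a x - beta * sqdist a z) => h1.
  have : G * (1 + (beta * sqdist a x - beta * sqdist a z)) <=
    G * expR (beta * sqdist a x - beta * sqdist a z) by rewrite ler_wpM2l.
  rewrite mulr0; lra.
have : (mean n x (fun z => G * (1 + beta * sqdist a x)%R + (G * q) * (z == x + y)%:R)%R <=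
        mean n x (fun z => gauss beta a z + (G * beta) * sqdist a z)%R)%E.
  apply: (mean_le mc) => // z.
    by apply: addr_ge0; apply: mulr_ge0 => //; [exact: addr_ge0|exact: mulr_ge0].
  by rewrite addr_ge0 ?gauss_ge0// -mulrA; exact: mulr_ge0.
rewrite (@mean_affine _ _ _ _ _ _ _ mc n x _ _ (fun z => (z == x + y)%:R)); last 3 first.
- by apply: mulr_ge0 => //; exact: addr_ge0.
- exact: mulr_ge0.
- by [].
rewrite (@meanD _ _ _ _ _ _ _ mc n x (gauss beta a) (fun z => (G * beta) * sqdist a z)); last 2 first.
- exact: gauss_ge0.
- by move=> z; rewrite -mulrA; exact: mulr_ge0.
rewrite (@meanZ _ _ _ _ _ _ _ mc n x (G * beta) (sqdist a)); last 2 first.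
- exact: mulr_ge0.
- exact: sqdist_ge0.
rewrite mean_eq => h.
have {}h : ((G * (1 + beta * sqdist a x))%:E + (G * q)%:E * kappa%:E <=
   mean n x (gauss beta a) + (G * beta)%:E * (sqdist a x + L)%:E)%E.
  apply: le_trans (le_trans h _).
    by rewrite leeD2l// lee_wpmul2l// lee_fin mulr_ge0.
  by rewrite leeD2l// lee_wpmul2l// lee_fin mulr_ge0.
rewrite -!EFinM -EFinD -leeBlDr// in h.
by apply: le_trans h; rewrite -EFinB lee_fin; lra.
Qed.

Lemma gauss_gain (c : R) : 0 < c -> exists lambda R2 : R, 0 < lambda /\
  forall r x a, R2 <= r -> r / 8 <= enorm (toR x : 'rV[R]_d) ->
    enorm a <= 2 * r -> c * r <= enorm (toR x - a) -> S x ->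
    ((gauss (lambda / r ^+ 2) a x * (1 + (r ^+ 2)^-1))%:E <=
      mean n x (gauss (lambda / r ^+ 2) a))%E.
Proof.
move=> c0.
have k0 : 0 < k%:R :> R by rewrite ltr0n.
have d0 : 0 < d%:R :> R by rewrite ltr0n.
(* With m = c r / sqrt d, the elliptic gain is lam^2 A / r^2 and the loss lam L / r^2. The choice of
   [lam] gives lam A >= L + 1, hence a net gain of at least lam / r^2 >= 1 / r^2. *)
pose A := kappa * k%:R ^+ 2 * c ^+ 2 / (4 * d%:R).
have A0 : 0 < A by rewrite divr_gt0 ?mulr_gt0 ?exprn_gt0.
pose lam := (L + 1) / A + 1.
have l1 : 1 <= lam by rewrite lerDr; apply: divr_ge0; [exact: addr_ge0|exact: ltW].
have lA : L + 1 <= lam * A by rewrite mulrDl mul1r divfK ?gt_eqF// lerDl ltW.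
exists lam, (1 + `|R1| + k%:R * Num.sqrt d%:R / c); split; first by lra.
move=> r x a hr hx ha hc Sx.
have s0 : 0 < Num.sqrt d%:R :> R by rewrite sqrtr_gt0.
have ss : Num.sqrt d%:R ^+ 2 = d%:R :> R by rewrite sqr_sqrtr ?ltW.
have kc : 0 <= k%:R * Num.sqrt d%:R / c by rewrite divr_ge0 ?mulr_ge0 ?ltW.
have r1 : 1 <= r by have := normr_ge0 R1; lra.
have r0 : 0 < r by lra.
have rR1 : R1 <= r by have := ler_norm R1; lra.
pose m := c * r / Num.sqrt d%:R.
have km : k%:R <= m.
  by rewrite ler_pdivlMr// mulrC [c * r]mulrC -ler_pdivrMr//; have := normr_ge0 R1; lra.
have m2 : m ^+ 2 * d%:R = (c * r) ^+ 2 by rewrite /m exprMn exprVn ss divfK ?gt_eqF.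
have mx : m ^+ 2 * d%:R <= sqdist a x.
  by rewrite m2 /sqdist ler_pXn2r// nnegrE ?enorm_ge0// mulr_ge0 ?ltW.
have b0 : 0 <= lam / r ^+ 2 by rewrite divr_ge0 ?sqr_ge0//; lra.
apply: le_trans (gauss_mean_ge Sx b0 km mx (growth rR1 hx ha Sx)).
rewrite lee_fin ler_wpM2l ?gauss_ge0// -addrA lerD2l.
have -> : kappa * ((lam / r ^+ 2 * (k%:R * m)) ^+ 2 / 4) = lam * (lam * A) / r ^+ 2.
  have -> : (lam / r ^+ 2 * (k%:R * m)) ^+ 2 =
      lam ^+ 2 * k%:R ^+ 2 * (m ^+ 2 * d%:R) / d%:R / r ^+ 2 / r ^+ 2.
    by field; rewrite ?gt_eqF.
  by rewrite m2 /A; field; rewrite ?gt_eqF.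
have -> : lam * (lam * A) / r ^+ 2 - lam / r ^+ 2 * L =
    (lam * (lam * A) - lam * L) / r ^+ 2 by ring.
rewrite ler_peMl ?invr_ge0 ?sqr_ge0//.
have : lam * (L + 1) <= lam * (lam * A) by rewrite ler_wpM2l//; lra.
lra.
Qed.

(* The maximum principle is applied to g + delta * gauss: outside B(a, 3r/4) it is
   at most 1 + delta * exp (- 9 lambda / 16) because gauss is small, and on B(a, c r)
   it is at most 1 by hypothesis. *)
Lemma gauss_propagate (g : V -> R) (c : R) : 0 < c ->
  (forall x, 0 <= g x <= 1) -> (forall x, S x -> ((g x)%:E <= mean n x g)%E) ->
  propagates S g c.
Proof.
move=> c0 g01 gsub; have [lam [R2 [l0 gain]]] := gauss_gain c0.
(* The difference between the values of the Gaussian at distances r / 2 and 3 r / 4 from its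
   centre. *)
exists (expR (- (lam / 4)) - expR (- (lam * (9 / 16)))), (`|R2| + 1); split.
  rewrite subr_gt0 ltr_expR; apply/andP; split; first by lra.
  have : expR (- (lam / 4)) <= expR 0 by rewrite ler_expR; lra.
  by have := expR_gt0 (- (lam * (9 / 16))); rewrite expR0; lra.
move=> r a delta hr a1 a2 /andP[dl0 dl1] near x Sx xa.
have r1 : 1 <= r by have := normr_ge0 R2; lra.
have rR2 : R2 <= r by have := ler_norm R2; lra.
have r2 : 0 < r ^+ 2 by rewrite exprn_gt0//; lra.
have dn := ltW dl0; set b := lam / r ^+ 2 in gain *.
have b0 : 0 <= b by rewrite divr_ge0 ?ltW.
set l := expR (- (lam * (9 / 16))).
have l0' : 0 < l by exact: expR_gt0.
have brE (s : R) : b * (s * r) ^+ 2 = lam * s ^+ 2.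
  by rewrite /b; field; rewrite gt_eqF//; lra.
have gfar z : (3 / 4) * r <= enorm (toR z - a) -> gauss b a z <= l.
  move=> h; rewrite ler_expR lerN2.
  have -> : lam * (9 / 16) = b * (3 / 4 * r) ^+ 2 by rewrite brE; lra.
  by rewrite ler_wpM2l// ler_pXn2r// nnegrE ?enorm_ge0//; lra.
have gclose z s : 0 <= s -> enorm (toR z - a) <= s * r -> expR (- (lam * s ^+ 2)) <= gauss b a z.
  move=> s0 h; rewrite ler_expR lerN2 -brE.
  rewrite ler_wpM2l// ler_pXn2r// nnegrE ?enorm_ge0//.
  by rewrite mulr_ge0//; lra.
pose w z := g z + delta * gauss b a z.
have w0 z : 0 <= w z.
  by apply: addr_ge0; [case/andP: (g01 z)|rewrite mulr_ge0 ?gauss_ge0].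
have e0 : 0 < delta * (l / r ^+ 2) by rewrite mulr_gt0// divr_gt0.
have dl : 0 <= delta * l by rewrite mulr_ge0// ltW.
suff wM : w x <= 1 + delta * l.
  have := gclose x (1 / 2) _ _; rewrite (_ : lam * (1 / 2) ^+ 2 = lam / 4); last by lra.
  have h : 1 / 2 * r = r / 2 by lra.
  rewrite h => /(_ _ xa) hg; have {}hg := hg ltac:(lra).
  have : delta * expR (- (lam / 4)) <= delta * gauss b a x by rewrite ler_wpM2l.
  by move: wM; rewrite /w -/l; lra.
apply: (@maximum_principle n w _ (delta * (l / r ^+ 2)) 1) => //; first by lra.
  move=> z _; have /andP[_ g1] := g01 z.
  have : delta * gauss b a z <= 1 * 1 by apply: ler_pM; rewrite ?gauss_ge0 ?gauss_le1.
  rewrite /w; lra.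
move=> z Sz Mw; have /andP[_ g1] := g01 z.
have zc : c * r <= enorm (toR z - a).
  rewrite leNgt; apply/negP => h; have := near z Sz (ltW h).
  have : delta * gauss b a z <= delta * 1 by rewrite ler_wpM2l ?gauss_le1.
  move: Mw; rewrite /w; lra.
have zf : enorm (toR z - a) < (3 / 4) * r.
  rewrite ltNge; apply/negP => /gfar h.
  have : delta * gauss b a z <= delta * l by rewrite ler_wpM2l.
  move: Mw; rewrite /w; lra.
(* Here 7/8 - 3/4 = 1/8, the distance from the origin that [gain] requires. *)
have z8 : r / 8 <= enorm (toR z : 'rV[R]_d).
  by have := enorm_distl a (toR z); rewrite enormB; lra.
have lz : l <= gauss b a z.
  have := gclose z (3 / 4) _ (ltW zf).
  by rewrite (_ : lam * (3 / 4) ^+ 2 = lam * (9 / 16)); [apply; lra|lra].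
have {gain}gain := gain r z a rR2 z8 a2 zc Sz.
rewrite (@meanD _ _ _ _ _ _ _ mc n z g (fun z => delta * gauss b a z)); last 2 first.
- by move=> y; case/andP: (g01 y).
- by move=> y; rewrite mulr_ge0 ?gauss_ge0.
rewrite (@meanZ _ _ _ _ _ _ _ mc n z delta (gauss b a))//; last exact: gauss_ge0.
rewrite {1}/w -addrA EFinD leeD//; first exact: gsub.
apply: (@le_trans _ _ (delta%:E * (gauss b a z * (1 + (r ^+ 2)^-1))%:E)%E); last first.
  by rewrite lee_wpmul2l// lee_fin ltW.
rewrite -EFinM lee_fin -mulrDr ler_wpM2l// mulrDr mulr1 lerD2l.
by rewrite ler_wpM2r// invr_ge0 ltW.
Qed.

End Gaussian.

(** * Chains of balls around the origin *)

Section Cones.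
Context {R : realType} {d : nat} (S : set 'rV[int]_d) (g : 'rV[int]_d -> R).
Implicit Types (x y : 'rV[int]_d) (a v p : 'rV[R]_d).
Hypothesis propagate : forall c, 0 < c -> propagates S g c.

(** For a unit vector [v], [t] is the cosine of the half-angle: smaller [t] means a wider cone. *)
Definition bounded_on_cone v (t : R) := exists delta R0 : R, 0 < delta <= 1 /\
  forall x, S x -> R0 <= enorm (toR x : 'rV[R]_d) ->
    t * enorm (toR x : 'rV[R]_d) <= dot v (toR x) -> g x <= 1 - delta.

Lemma bounded_on_cone_le v t t' :
  t <= t' -> bounded_on_cone v t -> bounded_on_cone v t'.
Proof.
move=> tt' [delta [R0 [dl H]]]; exists delta, R0; split=> // x Sx hx hv.
by apply: H => //; apply: le_trans hv; rewrite ler_wpM2r ?enorm_ge0.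
Qed.

Lemma dot_unit_ge v a (b : R) : enorm v = 1 -> enorm a <= b -> - b <= dot v a.
Proof.
move=> v1 ab; rewrite lerNl -dotNl.
by apply: le_trans (cauchy_schwarz _ _) _; rewrite enormN v1 mul1r.
Qed.

(* The target ball is centred at a = x + (z / 2) |x| v: moving towards v raises the
   cosine by at least z ^ 2 / 8, unless x is already in the smaller cone. *)
Lemma bounded_on_cone_widen v (z t : R) : enorm v = 1 ->
  0 < z <= 1 / 4 -> `|t| <= 1 - z ->
  bounded_on_cone v t -> bounded_on_cone v (t - z ^+ 2 / 8).
Proof.
move=> v1 /andP[z0 z4]; rewrite ler_norml => /andP[t1 t2] [delta [R1 [/andP[dl0 dl1] H]]].
have z2 : 0 < z ^+ 2 by rewrite exprn_gt0.
have z2z : z ^+ 2 <= 1 / 16 by rewrite expr2; nra.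
have [|eta [R0 [/andP[e0 e1] prop]]] := @propagate (z ^+ 2 / 16); first by lra.
exists (eta * delta), (1 + `|R0| + 2 * `|R1|); split.
  by rewrite mulr_gt0//= -[leRHS]mulr1; apply: ler_pM => //; exact: ltW.
move=> x Sx hx hv; set r := enorm (toR x) in hx hv *.
have n0 := normr_ge0 R0; have n1 := normr_ge0 R1.
have r0 : 0 < r by lra.
have rR0 : R0 <= r by have := ler_norm R0; lra.
have rR1 : R1 <= r / 2 by have := ler_norm R1; lra.
pose s := dot v (toR x).
have s1 : - r <= s by exact: dot_unit_ge.
have s2 : s <= r.
  by apply: le_trans (cauchy_schwarz _ _) _; rewrite v1 mul1r.
pose b := z / 2 * r.
have b0 : 0 < b by rewrite mulr_gt0// divr_gt0.
have b8 : b <= r / 8 by rewrite /b; nra.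
pose a := toR x + b *: v.
have bv : enorm (b *: v) = b by rewrite enormZ v1 mulr1 gtr0_norm.
have ax : enorm (toR x - a) = b by rewrite /a opprD addrA subrr add0r enormN.
have aU : enorm a <= r + b by apply: le_trans (enormD _ _) _; rewrite bv.
have aL : r - b <= enorm a.
  by have := enorm_distl (toR x) (toR x - a); rewrite ax subKr.
have a2 : enorm a ^+ 2 = r ^+ 2 + 2 * b * s + b ^+ 2.
  rewrite enorm_sqr /a !dotE (dotC _ v) -/s -!enorm_sqr v1 -/r; ring.
(* The norm of [a] is needed from both sides, since the sign of [t] decides which bound controls t
   |a|. *)
have hlow : r + z / 2 * s <= enorm a.
  rewrite -(@ler_pXn2r _ 2)// ?nnegrE ?enorm_ge0//; last by nra.
  rewrite a2 /b; have : (z / 2) ^+ 2 * s ^+ 2 <= (z / 2) ^+ 2 * r ^+ 2.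
    by rewrite ler_wpM2l ?sqr_ge0//; nra.
  lra.
have hup : enorm a <= r + z / 2 * s + (z / 2) ^+ 2 * r / 2.
  rewrite -(@ler_pXn2r _ 2)// ?nnegrE ?enorm_ge0//; last by nra.
  rewrite a2 /b; have := sqr_ge0 (z / 2 * s + (z / 2) ^+ 2 * r / 2); lra.
have hta : t * enorm a <= t * (r + z / 2 * s) + (z / 2) ^+ 2 * r / 2.
  have q0 : 0 <= (z / 2) ^+ 2 * r / 2 by rewrite divr_ge0// mulr_ge0 ?sqr_ge0 ?ltW.
  have [t0|t0] := leP 0 t.
    have : t * enorm a <= t * (r + z / 2 * s + (z / 2) ^+ 2 * r / 2) by rewrite ler_wpM2l.
    have : t * ((z / 2) ^+ 2 * r / 2) <= 1 * ((z / 2) ^+ 2 * r / 2).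
      by rewrite ler_wpM2r//; lra.
    lra.
  have : t * enorm a <= t * (r + z / 2 * s) by rewrite ler_nM2l.
  lra.
apply: (prop r a) => //; rewrite ?dl0//; [lra|lra| |by rewrite ax; lra].
move=> y Sy ya; set c := z ^+ 2 / 16 * r in ya.
have cr : c <= r / 256 by rewrite /c; nra.
have c0 : 0 <= c by rewrite mulr_ge0 ?ltW//; lra.
have yL : enorm a - c <= enorm (toR y : 'rV[R]_d).
  have := enorm_distl a (a - toR y); rewrite subKr enormB; lra.
have yU : enorm (toR y : 'rV[R]_d) <= enorm a + c.
  have := enormD a (toR y - a); rewrite addrC subrK; lra.
apply: H => //; first by lra.
have hty : t * enorm (toR y : 'rV[R]_d) <= t * enorm a + c.
  have [t0|t0] := leP 0 t.
    have : t * enorm (toR y : 'rV[R]_d) <= t * (enorm a + c) by rewrite ler_wpM2l.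
    nra.
  have : t * enorm (toR y : 'rV[R]_d) <= t * (enorm a - c) by rewrite ler_nM2l.
  nra.
have vy : s + b - c <= dot v (toR y).
  have -> : dot v (toR y) = dot v a + dot v (toR y - a).
    by rewrite -dotDr addrC subrK.
  have -> : dot v a = s + b by rewrite /a dotDr dotZr -enorm_sqr v1 expr1n mulr1.
  by have := dot_unit_ge v1 ya; lra.
(* Multiplied by z / 2, this leaves a slack of z^2 r / 2. It pays for three amounts of z^2 r / 8:
   the error in |a|, the widening of the cone, and twice the radius c. *)
have ts : t * s <= (1 - z) * r.
  apply: le_trans (ler_norm _) _; rewrite normrM; apply: ler_pM => //.
    by rewrite ler_norml t1.
  by rewrite ler_norml s1.
have := ler_wpM2l (ltW (divr_gt0 z0 (ltr0n _ 2))) ts.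
move: hta hty vy hv; rewrite -/s /b /c => *; lra.
Qed.

(** Each widening lowers the cosine by the fixed amount z^2 / 8, so finitely many suffice; the
    maximum with -(1 - z) keeps it in the admissible range. *)
Lemma bounded_on_cone_iter v (z t : R) : enorm v = 1 ->
  0 < z <= 1 / 4 -> `|t| <= 1 - z ->
  bounded_on_cone v t -> bounded_on_cone v (- (1 - z)).
Proof.
move=> v1 hz ht Ht; have /andP[z0 z4] := hz.
have [t1 t2] : - (1 - z) <= t /\ t <= 1 - z by move: ht; rewrite ler_norml => /andP.
pose q := z ^+ 2 / 8; have q0 : 0 < q by rewrite divr_gt0 ?exprn_gt0.
have step m : bounded_on_cone v (Num.max (- (1 - z)) (t - m%:R * q)).
  elim: m => [|m IH]; first by rewrite mul0r subr0 max_r.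
  apply: bounded_on_cone_le (bounded_on_cone_widen v1 hz _ IH).
    rewrite -/q -natr1 mulrDl mul1r /Num.max; case: ifPn; case: ifPn; rewrite -?leNgt; lra.
  have mq : 0 <= m%:R * q by rewrite mulr_ge0 ?(ltW q0).
  rewrite ler_norml /Num.max; case: ifPn; rewrite -?leNgt => *; apply/andP; split; lra.
have [m hm] : exists m : nat, 2 < m%:R * q.
  exists (Num.bound `|2 / q|); rewrite -ltr_pdivrMr//.
  by apply: le_lt_trans (ler_norm _) _; exact: archi_boundP.
by have := step m; rewrite max_l//; lra.
Qed.

(* Near the direction -v, moving towards v would run into the origin; a sideways step
   along p is used instead. This is where the dimension must be at least 2. *)
Lemma bounded_outside_ball v p : enorm v = 1 -> enorm p = 1 -> dot v p = 0 ->
  bounded_on_cone v (- (1 - 1 / 40)) ->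
  exists delta R0 : R, 0 < delta <= 1 /\
    forall x, S x -> R0 <= enorm (toR x : 'rV[R]_d) -> g x <= 1 - delta.
Proof.
move=> v1 p1 vp [delta [R1 [/andP[dl0 dl1] H]]].
have [|eta [R0 [/andP[e0 e1] prop]]] := @propagate (1 / 40); first by lra.
exists (eta * delta), (1 + `|R0| + `|R1|); split.
  by rewrite mulr_gt0//= -[leRHS]mulr1; apply: ler_pM => //; exact: ltW.
move=> x Sx hx; set r := enorm (toR x) in hx *.
have n0 := normr_ge0 R0; have n1 := normr_ge0 R1.
have r0 : 0 < r by lra.
have rR0 : R0 <= r by have := ler_norm R0; lra.
have rR1 : R1 <= r by have := ler_norm R1; lra.
(* Choosing the sign of [p] makes the sideways step lead away from the origin: |a|^2 >= 5/4 r^2, and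
   111/100 < sqrt (5/4). *)
wlog px : p p1 vp / 0 <= dot p (toR x).
  move=> wl; have [|px] := leP 0 (dot p (toR x)); first exact: wl.
  apply: (wl (- p)); rewrite ?enormN ?dotNr ?vp ?oppr0// dotNl oppr_ge0; exact: ltW.
pose a := toR x + (r / 2) *: p.
have bp : enorm ((r / 2) *: p) = r / 2 by rewrite enormZ p1 mulr1 gtr0_norm//; lra.
have ax : enorm (toR x - a) = r / 2 by rewrite /a opprD addrA subrr add0r enormN.
have aU : enorm a <= r + r / 2 by apply: le_trans (enormD _ _) _; rewrite bp.
have aL : 111 / 100 * r <= enorm a.
  rewrite -(@ler_pXn2r _ 2)// ?nnegrE ?enorm_ge0//; last by lra.
  rewrite enorm_sqr /a !dotE (dotC _ p) -!enorm_sqr p1 -/r.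
  by have := mulr_ge0 (ltW r0) px; have := sqr_ge0 r; lra.
apply: (prop r a) => //; rewrite ?dl0//; [lra|lra| |by rewrite ax].
move=> y Sy ya.
have yL : enorm a - 1 / 40 * r <= enorm (toR y : 'rV[R]_d).
  have := enorm_distl a (a - toR y); rewrite subKr enormB; lra.
apply: H => //; first by lra.
have -> : dot v (toR y) = dot v (toR x) + dot v (toR y - a).
  have -> : dot v (toR x) = dot v a by rewrite /a dotDr dotZr vp mulr0 addr0.
  by rewrite -dotDr addrC subrK.
(* The step leaves v . x >= - r unchanged but lengthens the vector: v . y >= - 41/40 r, while |y| >=
   (111/100 - 1/40) r and 39/40 of that exceeds 41/40 r. *)
have := dot_unit_ge v1 ya; have := dot_unit_ge v1 (lexx (enorm (toR x))).
by rewrite -/r; lra.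
Qed.

(** The kernel of the column [v^T] has dimension at least d - 1 > 0; normalise one of its nonzero
    vectors. *)
Lemma exists_orthogonal v : (2 <= d)%N -> exists2 p, enorm p = 1 & dot v p = 0.
Proof.
move=> d2; pose K := kermx v^T.
have K0 : K != 0.
  rewrite -mxrank_eq0 mxrank_ker -lt0n subn_gt0.
  by apply: leq_ltn_trans (rank_leq_col _) _.
pose q := nz_row K; have q0 : q != 0 by rewrite nz_row_eq0.
have qv : dot v q = 0.
  have : (q <= K)%MS by exact: nz_row_sub.
  move/sub_kermxP/matrixP => /(_ 0 0); rewrite !mxE => <-.
  by apply: eq_bigr => i _; rewrite !mxE mulrC.
have e0 : enorm q != 0 by apply: contra_neq q0; exact: enorm_eq0.
exists ((enorm q)^-1 *: q); last by rewrite dotZr qv mulr0.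
by rewrite enormZ ger0_norm ?invr_ge0 ?enorm_ge0// mulVf.
Qed.

End Cones.

(** * Exit from the cone *)

Section Exit.
Context {R : realType} {disp : measure_display} {T : measurableType disp}.
Context {d : nat} {S : set 'rV[int]_d} (P : 'rV[int]_d -> probability T R).
Context (xi : nat -> T -> 'rV[int]_d) (mc : markov_chain S P xi).
Local Notation V := 'rV[int]_d.
Local Notation mean := (@mean R disp T d P xi).
Implicit Types (x y z : V) (g : V -> R).

Lemma reachable_state n x z : S x -> (0 < P x [set w | xi n w = z])%E -> S z.
Proof.
move=> Sx; apply: contraPP => nSz; apply/negP; rewrite -leNgt.
have mS : measurable [set w | S (xi n w)].
  exact: (measurable_preimage_countable (mc_measurable mc n) S).
have <- : P x (~` [set w | S (xi n w)]) = 0%E.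
  by rewrite probability_setC// (mc_states mc)// subee.
apply: le_measure; rewrite ?inE; [exact: (mc_measurable mc)|exact: measurableC|].
by move=> w /= ->.
Qed.

(** Integrate the pointwise bound g + (1 - g z) 1_{z} <= 1: the deficit at z is passed on to x with
    factor [kappa]. *)
Lemma mean_le_jump n x z (kappa : R) g : (forall y, 0 <= g y <= 1) ->
  (kappa%:E <= P x [set w | xi n w = z])%E -> ((g x)%:E <= mean n x g)%E ->
  S x -> g x <= 1 - kappa * (1 - g z).
Proof.
move=> g01 hk hg Sx; have g1 y : 0 <= 1 - g y by case/andP: (g01 y); lra.
have g0 y : 0 <= g y by case/andP: (g01 y).
have : (mean n x (fun y => g y + (1 - g z) * (y == z)%:R)%R <= mean n x (cst 1%R))%E.
  apply: (mean_le mc) => // y *; first by rewrite addr_ge0 ?mulr_ge0.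
  by have [->|_] := eqVneq y z; rewrite /= ?mulr1 ?mulr0; have := g1 y; lra.
rewrite mean_cst (@meanD _ _ _ _ _ _ _ mc n x g (fun y => (1 - g z) * (y == z)%:R)) //;
  last by move=> y; rewrite mulr_ge0.
rewrite (@meanZ _ _ _ _ _ _ _ mc n x (1 - g z) (fun y => (y == z)%:R))//.
rewrite (mean_eq mc) => h.
suff : ((g x)%:E + (1 - g z)%:E * kappa%:E <= 1%:E)%E.
  by rewrite -EFinM -EFinD lee_fin; lra.
by apply: le_trans h; rewrite leeD// lee_wpmul2l// lee_fin.
Qed.

(** Each elliptic step raises the i-th coordinate by k >= 1. Inside the ball this coordinate is at
    least - R0, so a number of steps above 2 R0, the same for all x, leads out; every step costs a
    factor [kappa] in the deficit. *)
Lemma bounded_by_walk n (k : nat) (i : 'I_d) (kappa delta R0 : R) g :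
  0 < kappa -> (0 < k)%N -> (forall y, 0 <= g y <= 1) ->
  (forall x, S x -> ((g x)%:E <= mean n x g)%E) ->
  (forall x, S x ->
    (kappa%:E <= P x [set w | xi n w = (x + k%:Z *: delta_mx 0 i)%R])%E) ->
  0 < delta ->
  (forall x, S x -> R0 <= enorm (toR x : 'rV[R]_d) -> g x <= 1 - delta) ->
  exists2 delta' : R, 0 < delta' & forall x, S x -> g x <= 1 - delta'.
Proof.
move=> k0 kn g01 gsub ell dl0 H.
have walk m : exists2 dm : R, 0 < dm &
    forall x, S x -> R0 - m%:R <= (toR x : 'rV[R]_d) 0 i -> g x <= 1 - dm.
  elim: m => [|m [dm dm0 IH]].
    exists delta => // x Sx; rewrite subr0 => hx; apply: H => //.
    by apply: le_trans (le_trans hx (ler_norm _)) (enorm_coord _ i).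
  exists (kappa * dm); first exact: mulr_gt0.
  move=> x Sx hx; set z := x + k%:Z *: delta_mx 0 i.
  have Sz : S z by apply: reachable_state Sx (lt_le_trans _ (ell x Sx)); rewrite lte_fin.
  have := mean_le_jump g01 (ell x Sx) (gsub x Sx) Sx; rewrite -/z.
  have : g z <= 1 - dm.
    apply: IH => //; rewrite /z toRD toR_delta !mxE !eqxx /= mulr1.
    have : 1 <= k%:R :> R by rewrite ler1n.
    by move: hx; rewrite -natr1 mxE; lra.
  move=> gz; have : kappa * dm <= kappa * (1 - g z) by rewrite ler_wpM2l ?(ltW k0)//; lra.
  lra.
have [m hm] : exists m : nat, 2 * R0 < m%:R.
  exists (Num.bound `|2 * R0|).
  by apply: le_lt_trans (ler_norm _) _; exact: archi_boundP.
have [dm dm0 hdm] := walk m.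
exists (Num.min delta dm); first by rewrite lt_min dl0.
move=> x Sx; have [hx|hx] := leP R0 (enorm (toR x : 'rV[R]_d)).
  by apply: le_trans (H x Sx hx) _; rewrite lerD2l lerN2 ge_min lexx.
apply: le_trans (hdm x Sx _) _; last by rewrite lerD2l lerN2 ge_min lexx orbT.
have := enorm_coord (toR x : 'rV[R]_d) i; rewrite ler_norml => /andP[h _].
lra.
Qed.

Lemma cprob_start A x : S x ->
  cprob (P x) A (at_time xi 0 x) = P x (A `&` at_time xi 0 x).
Proof. by move=> Sx; rewrite /cprob (mc_start mc Sx) inve1 mule1. Qed.

Lemma step_second_moment x : S x ->
  cexp (P x) (fun w => enorm (toR (xi 1%N w - xi 0%N w)) ^+ 2)%R (at_time xi 0 x)
    = mean 1 x (sqdist (toR x)).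
Proof.
move=> Sx; rewrite /cexp (mc_start mc Sx) inve1 mule1.
have m0 : measurable (at_time xi 0 x) by exact: (mc_measurable mc).
rewrite /mean (@ge0_negligible_integral _ _ _ _ setT (~` at_time xi 0 x)); last 5 first.
- exact: measurableC.
- by [].
- exact: (measurable_chain_EFin mc).
- by move=> w _; rewrite lee_fin sqdist_ge0.
- by apply: (etrans (probability_setC (P x) m0)); rewrite (mc_start mc Sx) subee.
rewrite setTD setCK; apply: eq_integral => w /set_mem/= w0.
by rewrite /sqdist toRB w0.
Qed.

Lemma exit_time_fin (u : 'rV[R]_d) (alpha : R) w :
  (exit_time xi u alpha w < +oo)%E <-> exists t, ~ cone u alpha (toR (xi t w)).
Proof.
split=> [|[t ht]].
  apply: contraPP => /forallNP h; rewrite /exit_time.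
  rewrite (_ : [set _ | _ in _] = set0) ?ereal_inf0 ?ltxx//.
  by rewrite -subset0 => _ [t /= ht _]; exact: (h t).
apply: (@le_lt_trans _ _ t%:R%:E); last exact: ltry.
by apply: ereal_inf_lbound; exists t.
Qed.

End Exit.

Theorem theorem2p1 (R : realType) (disp : measure_display)
    (T : measurableType disp) (d : nat) (hd : (2 <= d)%N)
    (S : set 'rV[int]_d) (P : 'rV[int]_d -> probability T R)
    (xi : nat -> T -> 'rV[int]_d)
    (S_unbounded : forall M : R, exists x : 'rV[int]_d, S x /\ M < enorm (toR x))
    (Xi : markov_chain S P xi)
    (A1 : exists (kappa : R) (k n0 : nat),
        [/\ 0 < kappa, (0 < k)%N, (0 < n0)%N &
        forall (z x y : 'rV[int]_d) (t : nat), S z -> S x ->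
          (exists i : 'I_d, y = k%:Z *: delta_mx 0 i
                         \/ y = - (k%:Z *: delta_mx 0 i)) ->
          (0 < P z (at_time xi t x))%E ->
          (kappa%:E <= cprob (P z) [set w | (xi (t + n0)%N w - xi t w)%R = y]
                             (at_time xi t x))%E])
    (A2 : exists B0 : R, 0 < B0 /\
        forall (z x : 'rV[int]_d) (t : nat), S z -> S x ->
          (0 < P z (at_time xi t x))%E ->
          (cexp (P z) (fun w => enorm (toR (xi t.+1 w - xi t w)) ^+ 2)%R
                (at_time xi t x) <= B0%:E)%E)
    (drift_bound : exists C r0 : R,
        forall x : 'rV[int]_d, S x -> r0 <= enorm (toR x :> 'rV[R]_d) ->
          enorm (mean_drift P xi x) <= C * (enorm (toR x))^-1)
    (alpha : R) (halpha : 0 < alpha < pi)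
    (u : 'rV[R]_d) (hu : enorm u = 1)
    (x : 'rV[int]_d) (hxS : S x) (hxW : cone u alpha (toR x)) :
  P x [set w | (exit_time xi u alpha w < +oo)%E] = 1%E.
Proof.
have [kappa [k [n0 [kappa0 k0 n00 ell]]]] := A1.
have [B0 [B0p mom]] := A2; have [C [r0 drift]] := drift_bound.
have d0 : (0 < d)%N by exact: ltnW.
(* The conditional hypotheses are used at time 0 under the law [P y], where the conditioning event
   has probability 1. *)
have mom1 y : S y -> (mean P xi 1 y (sqdist (toR y)) <= B0%:E)%E.
  move=> Sy; rewrite -(step_second_moment Xi Sy); apply: mom => //.
  by rewrite (mc_start Xi Sy) lte01.
have {}ell y z : S y -> (exists i : 'I_d, z = k%:Z *: delta_mx 0 i \/
    z = - (k%:Z *: delta_mx 0 i)) ->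
    (kappa%:E <= P y [set w | xi n0 w = (y + z)%R])%E.
  move=> Sy hz; have := ell y y z 0%N Sy Sy hz.
  rewrite (mc_start Xi Sy) lte01 (cprob_start Xi _ Sy) add0n => /(_ isT) h.
  apply: le_trans h _; apply: le_measure; rewrite ?inE.
  - apply: measurableI; last exact: (mc_measurable Xi).
    rewrite (_ : [set w | _] = \bigcup_v (at_time xi 0 v `&` at_time xi n0 (v + z))).
      apply: countable_bigcupT_measurable => [|v]; first exact: countableP.
      by apply: measurableI; exact: (mc_measurable Xi).
    apply/seteqP; split=> w /=.
      by move=> hw; exists (xi 0%N w) => //; split=> //=; rewrite -hw addrC subrK.
    by case=> v _ [/= -> ->]; rewrite addrC addKr.
  - exact: (mc_measurable Xi).
  by move=> w [/= <- ->]; rewrite addrC subrK.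
have [L [R1 [L0 growth]]] := sqdist_growth Xi (ltW B0p) mom1 drift n0.
pose W := [set z | cone u alpha (toR z)].
pose g y := fine (survive_ever P xi W y).
have gfin y : survive_ever P xi W y = (g y)%:E.
  rewrite fineK// ge0_fin_numE ?survive_ever_ge0//.
  by rewrite (le_lt_trans (survive_ever_le1 Xi W y))// ltry.
have g01 y : 0 <= g y <= 1.
  by rewrite -!lee_fin -gfin survive_ever_ge0 (survive_ever_le1 Xi).
have gsub y : S y -> ((g y)%:E <= mean P xi n0 y g)%E.
  move=> Sy; rewrite -gfin; apply: le_trans (survive_ever_chain Xi W n0 Sy) _.
  by rewrite /mean; under eq_integral do rewrite gfin.
have gW y : ~ cone u alpha (toR y) -> g y = 0.
  move=> ny; apply/eqP; rewrite eq_le; case/andP: (g01 y) => -> _; rewrite andbT.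
  rewrite -lee_fin -gfin; apply: le_trans (survive_ever_le P xi W 1 y) _.
  by rewrite /survive /= /step asboolF.
have prop c (c0 : 0 < c) : propagates S g c.
  exact: (@gauss_propagate _ _ _ _ _ _ _ Xi n0 k kappa kappa0 k0 d0
  ell L R1 L0 growth g c c0 g01 gsub).
have v1 : enorm (- u) = 1 by rewrite enormN.
have /andP[al0 alpi] := halpha.
have cos1 : `|cos alpha| < 1.
  have s0 : 0 < sin alpha by apply: sin_gt0_pi; rewrite al0.
  rewrite -(@ltr_pXn2r _ 2)// ?nnegrE// expr1n real_normK ?num_real//.
  have := cos2Dsin2 alpha; have : 0 < sin alpha ^+ 2 by rewrite exprn_gt0.
  lra.
(* The second bound admits the initial cosine - cos alpha into the widening; the first makes the
   final cone reach the cosine -(1 - 1/40) required by [bounded_outside_ball]. *)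
pose z := Num.min (1 / 40) (1 - `|cos alpha|).
have z1 : z <= 1 / 40 by rewrite ge_min lexx.
have z2 : z <= 1 - `|cos alpha| by rewrite ge_min lexx orbT.
have z0 : 0 < z <= 1 / 4 by rewrite lt_min subr_gt0 cos1 andbT; apply/andP; split; lra.
(* The complement of the cone is a closed cone about - u, on which g = 0: so delta = 1 and no lower
   bound on |y| is imposed. *)
have base : bounded_on_cone S g (- u) (- cos alpha).
  exists 1, 0; split; first by rewrite ltr01 lexx.
  move=> y Sy _ hy; rewrite gW ?subrr// => -[y0]; rewrite dotZr.
  have ypos : 0 < enorm (toR y : 'rV[R]_d).
    by rewrite lt_neqAle enorm_ge0 andbT eq_sym; apply: contra_neq y0; exact: enorm_eq0.
  rewrite mulrC ltr_pdivlMr// => lt.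
  by move: hy; rewrite dotNl mulNr lerN2 leNgt lt.
have [p p1 up] := exists_orthogonal (- u) hd.
have [|delta [R0 [/andP[dl0 _] far]]] := bounded_outside_ball prop v1 p1 up.
  apply: bounded_on_cone_le (bounded_on_cone_iter prop v1 z0 _ base); first by lra.
  by rewrite normrN; lra.
have [|del del0 gdel] := bounded_by_walk Xi (i := Ordinal d0) kappa0 k0 g01 gsub _ dl0 far.
  by move=> y Sy; apply: ell => //; exists (Ordinal d0); left.
(* The maximum with 1/2 keeps the bound positive, since [del] may be 1 or more. *)
pose q := Num.max (1 - del) (1 / 2).
have q01 : 0 < q < 1.
  by rewrite lt_max gt_max; apply/andP; split; [apply/orP; right|apply/andP; split]; lra.
have gx0 : survive_ever P xi W x = 0%E.
  apply: (survive_ever_eq0 Xi q01) => // y Sy.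
  by rewrite gfin lee_fin le_max gdel.
have mN : measurable (\bigcap_n in_before xi W n).
  by apply: bigcap_measurable => // m _; exact: (measurable_in_before Xi).
have PN : P x (\bigcap_n in_before xi W n) = 0%E.
  by apply/eqP; rewrite -measure_le0 -gx0; exact: (stay_forever_le Xi).
have -> : [set w | (exit_time xi u alpha w < +oo)%E] = ~` \bigcap_n in_before xi W n.
  apply/seteqP; split=> w /=.
    (* [in_before] stops strictly before its index, so time [t] is read off from index [t.+1]. *)
    by move=> /exit_time_fin[t ht] h; apply: ht; exact: (h t.+1 I t (ltnSn t)).
  move=> h; apply/exit_time_fin; apply: contrapT => /forallNP h'; apply: h => m _ i _.
  by apply: contrapT; exact: h'.
by rewrite probability_setC// PN sube0.
Qed.
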